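(* Let $a>b>0$ and consider the magic billiard with flipping over the long axis in the table bounded by the ellipse $\mathcal{E}:\ \frac{x^2}{a}+\frac{y^2}{b}=1$. Consider a trajectory of this billiard with caustic $\mathcal{C}_\beta$. Let $n$ be a positive integer. The trajectory is $n$-periodic if and only if one of the following conditions is satisfied: (i) $n$ is even and $nQ_0\sim nQ_\infty$; (ii) $n$ is odd, $\mathcal{C}_\beta$ is a hyperbola, and $nQ_0\sim nQ_b$. Here $Q_0$, $Q_b$, $Q_\infty$ denote the points with coordinates $(0,\sqrt{ab\beta})$, $(b,0)$, $(\infty,\infty)$ on the elliptic curve $y^2=(a-x)(b-x)(\beta-x)$, and $\sim$ denotes linear equivalence of divisors on that curve.
   Context: Confocal family: $\mathcal{C}_\lambda:\ \frac{x^2}{a-\lambda}+\frac{y^2}{b-\lambda}=1$, so $\mathcal{E}=\mathcal{C}_0$; $\mathcal{C}_\lambda$ is an ellipse for $\lambda<b$ and a hyperbola for $b<\lambda<a$. Magic billiard with flipping over the long axis: let $D$ be the closed domain bounded by $\mathcal{E}$, and let $\varphi$ be the reflection of the plane with respect to the longer axis of $\mathcal{E}$, $\varphi(x,y)=(x,-y)$. A particle moves with unit speed along straight segments inside $D$. When it hits $\mathcal{E}$ at a point $A$ with velocity $\vec v$, it continues from the point $\varphi(A)$ with velocity $\varphi^*(\vec v)=d\varphi(\rho_A(\vec v))$, where $\rho_A$ is the usual billiard reflection (reflection of vectors with respect to the tangent line to $\mathcal{E}$ at $A$). Caustic: each trajectory has a unique conic $\mathcal{C}_\beta$ of the confocal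 family such that the lines containing the segments of the trajectory are all tangent to $\mathcal{C}_\beta$; it is called the caustic of the trajectory. The caustic is nondegenerate, i.e. $\beta\in(0,b)\cup(b,a)$, so that the curve is nonsingular; its projective closure has one point $Q_\infty$ at infinity. $n$-periodic: after $n$ consecutive hits at the boundary the particle returns to its initial position and velocity ($n$ is not required to be the minimal such number). *)

(* Defs.v *)
(* [R[i]] is the field of complex numbers over [R : realType], and [{freeg T}] is
   the free abelian group on [T]. *)
From HB Require Import structures.
From mathcomp Require Import all_boot all_order all_algebra all_field.
From mathcomp Require Import reals.
From mathcomp Require Import complex.
From mathcomp Require Import freeg.

Set Implicit Arguments.
Unset Strict Implicit.
Unset Printing Implicit Defensive.

Import Order.TTheory GRing.Theory Num.Theory.
Local Open Scope ring_scope.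
Local Open Scope complex_scope.

Section Billiard.
Variables (R : realType) (a b : R).
Implicit Types P v : 'rV[R]_2.

Definition dot (u v : 'rV[R]_2) : R := (u *m v^T) 0 0.

Definition on_boundary P : Prop := P 0 0 ^+ 2 / a + P 0 1 ^+ 2 / b = 1.

Definition in_table P : Prop := P 0 0 ^+ 2 / a + P 0 1 ^+ 2 / b <= 1.

(* Half of the gradient of x^2/a + y^2/b. *)
Definition normal P : 'rV[R]_2 :=
  \row_(j < 2) (if j == 0 then P 0 0 / a else P 0 1 / b).

Definition reflect_at P v : 'rV[R]_2 :=
  v - (2 * dot v (normal P) / dot (normal P) (normal P)) *: normal P.

(* As a linear map, [flip] is its own differential. *)
Definition flip P : 'rV[R]_2 :=
  \row_(j < 2) (if j == 0 then P 0 0 else - P 0 1).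

(* [pos 0] and [vel 0] are the initial position (anywhere in the closed table)
   and velocity; for k > 0, [pos k] and [vel k] are those just after the k-th
   hit and flip. The table is strictly convex, so there is at most one positive
   time at which the ray from [pos k] meets the boundary, and the particle stays
   in the table until then. *)
Record trajectory := Trajectory {
  pos : nat -> 'rV[R]_2;
  vel : nat -> 'rV[R]_2;
  flight : nat -> R;
  pos0_in_table : in_table (pos 0);
  unit_speed : dot (vel 0) (vel 0) = 1;
  flight_gt0 : forall k, 0 < flight k;
  hit_boundary : forall k, on_boundary (pos k + flight k *: vel k);
  pos_next : forall k, pos k.+1 = flip (pos k + flight k *: vel k);
  vel_next : forall k,
    vel k.+1 = flip (reflect_at (pos k + flight k *: vel k) (vel k)) }.

(* After n hits, and before the next one, the particle is at its initial
   position with its initial velocity. When it starts on the boundary, this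
   forces t = 0. *)
Definition n_periodic (T : trajectory) (n : nat) : Prop :=
  exists t : R, [/\ 0 <= t < flight T n,
    pos T 0 = pos T n + t *: vel T n & vel T 0 = vel T n].

(* The line P + Rv is the tangent line at some point (x0 : y0 : z0) of the
   projective closure of the conic; z0 = 0 accounts for the asymptotes of a
   hyperbola, which do contain segments of trajectories. *)
Definition tangent_to_conic (lambda : R) P v : Prop :=
  exists x0 y0 z0 : R, [/\ (x0, y0, z0) <> (0, 0, 0),
    x0 ^+ 2 / (a - lambda) + y0 ^+ 2 / (b - lambda) = z0 ^+ 2 &
    forall t : R, (P + t *: v) 0 0 * x0 / (a - lambda)
                + (P + t *: v) 0 1 * y0 / (b - lambda) = z0].

Definition is_caustic (lambda : R) (T : trajectory) : Prop :=
  forall k, tangent_to_conic lambda (pos T k) (vel T k).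

Definition conic_hyperbola (lambda : R) : Prop := b < lambda < a.

End Billiard.

Local Open Scope quotient_scope.

Lemma fractionE (A : idomainType) (r : {fraction A}) :
  exists n d : A, d != 0 /\ r = tofrac n / tofrac d.
Proof.
elim/quotW: r => u; exists \n_u, \d_u; split; first exact: denom_ratioP.
have d0 : tofrac \d_u != 0 by rewrite tofrac_eq0 denom_ratioP.
apply: (mulIf d0); rewrite divfK //; unlock tofrac; rewrite -[LHS]FracField.pi_mul.
apply/eqmodP => /=; rewrite FracField.equivfE /FracField.mulf.
by rewrite !numden_Ratio ?mulr1 ?denom_ratioP ?oner_neq0 // mulrC.
Qed.

Local Close Scope quotient_scope.

Lemma cubic_nonsquare (F : fieldType) (c : {poly F})
    (r : {fraction {poly F}}) :
  size c = 4%N -> r ^+ 2 != tofrac c.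
Proof.
move=> sz; apply/eqP; have [n [d [d0 ->]]] := fractionE r.
have d0' : tofrac d != 0 by rewrite tofrac_eq0.
rewrite expr_div_n => /(canRL (divfK (expf_neq0 2 d0'))).
rewrite -!rmorphXn -rmorphM /= => /eqP; rewrite tofrac_eq => /eqP E.
have c0 : c != 0 by rewrite -size_poly_gt0 sz.
have n0 : n != 0 by rewrite -sqrf_eq0 E mulf_neq0 ?expf_neq0.
move: (congr1 (fun p : {poly F} => odd (size p)) E).
rewrite !expr2 !size_mul ?mulf_neq0 // sz.
have: (0 < size n)%N by rewrite size_poly_gt0.
have: (0 < size d)%N by rewrite size_poly_gt0.
case: (size n) (size d) => [|m] [|l] //= _ _.
by rewrite !(addnS, addSn) /= !addnn !odd_double.
Qed.

Lemma sqrtC_realE (R : realType) (x : R) :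
  0 <= x -> sqrtC x%:C = (Num.sqrt x)%:C.
Proof.
move=> x0; rewrite -{1}[x]sqr_sqrtr // rmorphXn /= sqrCK //.
by rewrite ler0c sqrtr_ge0.
Qed.

Section Curve.
Variables (R : realType) (a b beta : R).

Definition cubic : {poly R[i]} :=
  ((a%:C)%:P - 'X) * ((b%:C)%:P - 'X) * ((beta%:C)%:P - 'X).

(* [None] is the point at infinity. *)
Definition on_curve (P : option (R[i] * R[i])) : bool :=
  if P is Some (x, y) then y ^+ 2 == cubic.[x] else true.

Definition point : Type := {P : option (R[i] * R[i]) | on_curve P}.
HB.instance Definition _ := Choice.on point.

Lemma cubic0 : cubic.[0] = (a * b * beta)%:C.
Proof. by rewrite /cubic !hornerE ?subr0 -!rmorphM. Qed.

Fact Q0_subproof : on_curve (Some (0, sqrtC (a * b * beta)%:C)).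
Proof. by rewrite /= cubic0 sqrtCK. Qed.

Fact Qb_subproof : on_curve (Some (b%:C, 0)).
Proof. by rewrite /= /cubic !hornerE subrr mulr0 mul0r expr0n. Qed.

Definition Q0 : point := Sub _ Q0_subproof.
Definition Qb : point := Sub _ Qb_subproof.
Definition Qinf : point := Sub None isT.

Let k := {fraction {poly R[i]}}.

Definition curve_poly : {poly k} := 'X^2 - (tofrac cubic)%:P.

Lemma size_cubic : size cubic = 4%N.
Proof.
have E (c : R[i]) : c%:P - 'X = - ('X - c%:P) by rewrite opprB.
rewrite /cubic !E mulrNN mulrN size_polyN.
by rewrite !size_mul ?mulf_neq0 ?polyXsubC_eq0 // !size_XsubC.
Qed.

Lemma curve_poly_mi : monic_irreducible_poly curve_poly.
Proof.
have sz : size curve_poly = 3%N by rewrite /curve_poly size_XnsubC.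
split; last by rewrite /curve_poly monicXnsubC.
apply: cubic_irreducible => [|r]; first by rewrite sz.
by rewrite /root !hornerE subr_eq0 cubic_nonsquare // size_cubic.
Qed.

(* The field C(x)[y] / (y^2 - cubic) of rational functions on the curve. *)
Definition function_field : fieldType := {poly %/ curve_poly with curve_poly_mi}.

Definition fconst (c : R[i]) : function_field :=
  qfpoly_const curve_poly_mi (tofrac c%:P).
Definition fx : function_field := qfpoly_const curve_poly_mi (tofrac 'X).
Definition fy : function_field := ('qX : {poly %/ curve_poly}).

(* In g : {poly {poly _}}, the outer variable is the first coordinate. *)
Definition eval2 (K : nzRingType) (g : {poly {poly K}}) (z : K * K) : K :=
  g.[z.1, z.2].

(* Affine coordinates in a chart of the projective closure around P, as rational
   functions and by their values at P. The point at infinity is (0 : 1 : 0), and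
   there the chart is (x/y, 1/y). *)
Definition local_coords (P : point) : function_field * function_field :=
  if val P is Some _ then (fx, fy) else (fx / fy, fy^-1).

Definition local_values (P : point) : R[i] * R[i] :=
  if val P is Some xy then xy else (0, 0).

(* w is an invertible element of the local ring at P. *)
Definition unit_at (P : point) (w : function_field) : Prop :=
  exists g h : {poly {poly R[i]}},
    [/\ eval2 g (local_values P) != 0, eval2 h (local_values P) != 0 &
        w = eval2 (map_poly (map_poly fconst) g) (local_coords P)
          / eval2 (map_poly (map_poly fconst) h) (local_coords P)].

(* These are local parameters when the curve is nonsingular, that is when a, b
   and beta are distinct. *)
Definition uniformizer (P : point) : function_field :=
  match val P with
  | Some (x0, y0) => if y0 == 0 then fy else fx - fconst x0
  | None => fx / fy
  end.

Definition has_order (P : point) (f : function_field) (m : int) : Prop :=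
  exists2 w, unit_at P w & f = uniformizer P ^ m * w.

Definition lin_equiv (D1 D2 : {freeg point}) : Prop :=
  exists2 f : function_field, f != 0 &
    forall P : point, has_order P f (coeff P (D1 - D2)).

End Curve.

Lemma Q0E (R : realType) (a b beta : R) : 0 <= a * b * beta ->
  val (Q0 a b beta) = Some (0, (Num.sqrt (a * b * beta))%:C).
Proof. by move=> ge0; rewrite /= sqrtC_realE. Qed.

(* Main.v *)
(* Write c(x) = (a-x)(b-x)(beta-x). For a position p and a velocity v, let U, V
   and W + (a-x)(b-x) be (a-x)(b-x) times the products <v,v>, <p,v> and <p,p> for
   the form u1 w1/(a-x) + u2 w2/(b-x). The matrix L with rows (V, -U) and (W, -V)
   satisfies L^2 = c. A flight followed by a reflection conjugates L by a
   polynomial matrix of determinant x^2, and the flip leaves L unchanged. If the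
   orbit closes up after n steps, the product of these transfer matrices,
   completed by a free flight, commutes with L, hence it is A + B L with
   A^2 - c B^2 = x^(2n): the function A + B y has divisor 2n(Q_0 - Q_oo). At x = a
   the nilpotent matrix L kills the vector (v1, p1), so A(a) = a^n; at x = b it
   kills (v2, p2), which the flips multiply by (-1)^n, so A(b) = (-b)^n. These
   signs and the parity of degrees tell how the coprime polynomials A - x^n and
   A + x^n share the factors of c, and each of them is a square up to these
   factors. For even n, A + B y is then a constant times a square, which gives a
   function with divisor n(Q_0 - Q_oo); for odd n there is one with divisor
   n Q_0 + Q_b - (n+1) Q_oo. For odd n the caustic is a hyperbola: A is real and
   changes sign between b and a, whereas c >= 0 there if beta < b.

   Conversely, such a function yields A and B as above. At x = 0 the kernel of
   each transfer matrix is an eigenline of L, so the product of the transfer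
   matrices times A - B L is divisible by x^(2n); by degrees the quotient is a
   constant unipotent matrix, that is, a free flight along the initial line, and
   the signs at a and b recover the coordinates themselves. *)
Require Import Defs.
From HB Require Import structures.
From mathcomp Require Import all_boot all_order all_algebra all_field.
From mathcomp Require Import reals.
From mathcomp Require Import complex.
From mathcomp Require Import freeg.
From mathcomp Require Import ring lra zify.

Set Implicit Arguments.
Unset Strict Implicit.
Unset Printing Implicit Defensive.

Import Order.TTheory GRing.Theory Num.Theory.
Local Open Scope ring_scope.
Local Open Scope complex_scope.

(** * Auxiliary identities for polynomials and for the chart at infinity *)

Lemma linear_poly_eq0 (A : nzRingType) (p q : A) :
  q%:P * 'X + p%:P = 0 -> p = 0 /\ q = 0.
Proof.
move=> E; split; [move: (congr1 (coefp 0) E) | move: (congr1 (coefp 1) E)];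
  by rewrite /= coefD coefMX !coefC ?coef0 /= ?add0r ?addr0.
Qed.

Lemma linear_polyE (A : nzRingType) (s : {poly A}) :
  (size s <= 2)%N -> s = (s`_1)%:P * 'X + (s`_0)%:P.
Proof.
move=> ss; apply/polyP => -[|[|i]]; rewrite coefD coefMX !coefC /= ?add0r ?addr0 //.
by rewrite nth_default // (leq_trans ss).
Qed.

Lemma clear_denominators (F : fieldType) (p q d e : F) : d != 0 -> e != 0 ->
  (d * e)%:P * ((q / e)%:P * 'X + (p / d)%:P)
  = (p * e)%:P + (q * d)%:P * 'X.
Proof.
move=> d0 e0; rewrite mulrDr mulrA -!polyCM addrC.
by congr (_%:P + _%:P * 'X); field.
Qed.

(** The equation of the curve divided by z^2, written in the coordinates t/z and 1/z. *)
Lemma chart_at_infinity (F : fieldType) (k1 k2 k3 t z : F) : z != 0 ->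
  z ^+ 2 = (k1 - t) * (k2 - t) * (k3 - t) ->
  t * (t / z) ^+ 2 =
  (k1 + k2 + k3) * (t / z * (t / z))
  - (k1 * k2 + k1 * k3 + k2 * k3) * (t / z * z^-1)
  + k1 * k2 * k3 * (z^-1 * z^-1) - 1.
Proof.
move=> z0 zE; apply: (mulfI (expf_neq0 2 z0)).
have -> : z ^+ 2 * (t * (t / z) ^+ 2) = t ^+ 3 by field.
set rhs := RHS; have -> : rhs = - z ^+ 2 + (k1 + k2 + k3) * t ^+ 2
   - (k1 * k2 + k1 * k3 + k2 * k3) * t + k1 * k2 * k3.
  by rewrite /rhs; field.
by rewrite zE; ring.
Qed.

(** One step of Horner's scheme at infinity, with u for x/y and t for x: the degree in t rises by
    one and the power of u by two, since t u^2 is regular there. *)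
Lemma chart_horner_step (F : comNzRingType) m (p c t u : F) :
  p * u ^+ (2 * m) * (t * u ^+ 2) + c * u ^+ (2 + 2 * m)
  = (p * t + c) * u ^+ (2 + 2 * m).
Proof. by rewrite exprD; ring. Qed.

(** Here t stands for y: the term in t keeps a spare factor u, which vanishes at infinity. *)
Lemma chart_horner_step2 (F : comNzRingType) m (p q t u : F) :
  p * u ^+ (2 + (2 + 2 * m)) + q * u ^+ (2 * m) * (t * u ^+ 3) * u
  = (p + q * t) * u ^+ (2 + (2 + 2 * m)).
Proof. by rewrite !exprD; ring. Qed.

Lemma cancel_Xn (F : idomainType) k n (M N p q : {poly F}) : (k <= n)%N ->
  M = N * 'X^k -> M * p = 'X^n * q -> N * p = 'X^(n - k) * q.
Proof.
move=> kn -> E; have X0 : 'X^k != 0 :> {poly F} by rewrite expf_neq0 ?polyX_eq0.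
by apply: (mulfI X0); rewrite !mulrA -exprD subnKC // -E ['X^k * N]mulrC.
Qed.

Lemma cancel_Xn_ge (F : idomainType) k n (M N p q : {poly F}) : (n <= k)%N ->
  M = N * 'X^k -> M * p = 'X^n * q -> 'X^(k - n) * N * p = q.
Proof.
move=> nk -> E; have X0 : 'X^n != 0 :> {poly F} by rewrite expf_neq0 ?polyX_eq0.
by apply: (mulfI X0); rewrite !mulrA -exprD subnKC // -E ['X^k * N]mulrC.
Qed.

(** * Functions on the curve *)

Section FunctionField.
Variables (R : realType) (a b beta : R).
Local Notation C := R[i].
Local Notation K := (function_field a b beta).
Local Notation point := (point a b beta).
Local Notation fconst := (@fconst R a b beta).
Local Notation cubic := (cubic a b beta).
Local Notation y := (fy a b beta).
Local Notation x := (fx a b beta).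

Definition fpoly (p : {poly C}) : K :=
  qfpoly_const (curve_poly_mi a b beta) (tofrac p).

Fact fpoly_zmod : zmod_morphism fpoly.
Proof. by move=> p q; rewrite /fpoly tofracB;
  exact: (qpolyC_is_zmod_morphism (curve_poly a b beta)). Qed.

Fact fpoly_monoid : monoid_morphism fpoly.
Proof.
split; first by rewrite /fpoly tofrac1.
by move=> p q; rewrite /fpoly tofracM;
  exact: (qpolyC_is_monoid_morphism (curve_poly a b beta)).2.
Qed.

HB.instance Definition _ := GRing.isZmodMorphism.Build {poly C} K fpoly fpoly_zmod.
HB.instance Definition _ := GRing.isMonoidMorphism.Build {poly C} K fpoly
  fpoly_monoid.

Lemma fpolyD p q : fpoly (p + q) = fpoly p + fpoly q. Proof. exact: rmorphD. Qed.
Lemma fpolyN p : fpoly (- p) = - fpoly p. Proof. exact: rmorphN. Qed.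
Lemma fpolyM p q : fpoly (p * q) = fpoly p * fpoly q. Proof. exact: rmorphM. Qed.
Lemma fpolyXn p n : fpoly (p ^+ n) = fpoly p ^+ n. Proof. exact: rmorphXn. Qed.
Lemma fpoly0 : fpoly 0 = 0. Proof. exact: rmorph0. Qed.
Lemma fpoly1 : fpoly 1 = 1. Proof. exact: rmorph1. Qed.

Let cp := curve_poly a b beta.
Let size_cp : size cp = 3%N.
Proof. by rewrite /cp /curve_poly size_XnsubC. Qed.
Let mkE : mk_monic cp = cp.
Proof. exact: mk_monicE (curve_poly_mi a b beta). Qed.

Let quot (r : {poly {fraction {poly C}}}) : K := in_qpoly cp r.

Let quotD (r s : {poly {fraction {poly C}}}) : quot (r + s) = quot r + quot s.
Proof. exact: in_qpolyD. Qed.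

Let quotM (r s : {poly {fraction {poly C}}}) : quot (r * s) = quot r * quot s.
Proof. by rewrite /quot (in_qpolyM cp). Qed.

Let quot_small (r : {poly {fraction {poly C}}}) : (size r <= 2)%N -> polyn
  (quot r : {poly %/ cp}) = r.
Proof. by move=> sr; apply: in_qpoly_small; rewrite mkE size_cp. Qed.

Let quot_eq0 (r : {poly {fraction {poly C}}}) : (size r <= 2)%N -> quot r = 0
  -> r = 0.
Proof. by move=> /quot_small {2}<- ->. Qed.

Let fpolyE p : fpoly p = quot (tofrac p)%:P.
Proof.
apply: (@val_inj _ _ {poly %/ cp}); rewrite [RHS]quot_small; first exact: qpolyCE.
by rewrite (leq_trans (size_polyC_leq1 _)).
Qed.

Lemma sqr_fy : y ^+ 2 = fpoly cubic.
Proof.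
have cp0 : quot cp = 0.
  apply: (@val_inj _ _ {poly %/ cp}) => /=.
  by rewrite mkE Pdiv.RingMonic.rmodpp // /cp /curve_poly monicXnsubC.
rewrite fpolyE -[RHS]add0r -cp0 -quotD subrK expr2.
by rewrite [RHS]quotM.
Qed.

(** A polynomial of degree at most 1 over C(x) is its own remainder modulo [curve_poly], so 1 and y
    are independent over C(x). *)
Lemma fpoly_fy_eq0 p q : fpoly p + fpoly q * y = 0 -> p = 0 /\ q = 0.
Proof.
rewrite !fpolyE -[y]/(quot 'X) -quotM -quotD addrC => E.
have s2 : (size ((tofrac q)%:P * 'X + (tofrac p)%:P)%R <= 2)%N.
  by rewrite size_MXaddC; case: ifP => // _; rewrite ltnS size_polyC_leq1.
have [/eqP + /eqP] := linear_poly_eq0 (quot_eq0 s2 E).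
by rewrite !tofrac_eq0 => /eqP -> /eqP ->.
Qed.

Lemma fpoly_inj : injective fpoly.
Proof.
move=> p q /eqP; rewrite -subr_eq0 -rmorphB /= => /eqP pq0.
have /fpoly_fy_eq0[] : fpoly (p - q) + fpoly 0 * y = 0.
  by rewrite pq0 rmorph0 mul0r addr0.
by move=> /eqP; rewrite subr_eq0 => /eqP.
Qed.

(** The linear remainder of f over C(x), with its two coefficients brought to a common
    denominator. *)
Lemma function_fieldE (f : K) :
  exists p q r : {poly C}, r != 0 /\ fpoly r * f = fpoly p + fpoly q * y.
Proof.
pose s : {poly {fraction {poly C}}} := polyn (f : {poly %/ cp}).
have sf : (size s <= 2)%N.
  by have := size_mk_monic (f : {poly %/ cp});
    rewrite [X in (_ < X)%N](_ : _ = 3%N) // mkE.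
have fE : f = quot s.
  by apply: (@val_inj _ _ {poly %/ cp}); rewrite [RHS]quot_small.
clearbody s.
have [p [d [d0 pE]]] := fractionE s`_0.
have [q [e [e0 qE]]] := fractionE s`_1.
exists (p * e), (q * d), (d * e); split; first by rewrite mulf_neq0.
have main : (tofrac (d * e))%:P * s
    = (tofrac (p * e))%:P + (tofrac (q * d))%:P * 'X.
  rewrite (linear_polyE sf) qE pE (tofracM d e) (tofracM p e) (tofracM q d).
  by apply: clear_denominators; rewrite tofrac_eq0.
rewrite fE !fpolyE -[y]/(quot 'X) -[LHS]quotM main.
by rewrite [LHS]quotD [X in _ + X]quotM.
Qed.

(** * Substitution of rational functions into bivariate polynomials *)

Implicit Types (P : point) (p q : {poly C}) (g h : {poly {poly C}}).

Fact fconst_zmod : zmod_morphism fconst.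
Proof. by move=> c d; rewrite -[RHS](rmorphB (fpoly \o polyC)). Qed.

Fact fconst_monoid : monoid_morphism fconst.
Proof.
split; first exact: (rmorph1 (fpoly \o polyC)).
by move=> c d; rewrite -[RHS](rmorphM (fpoly \o polyC)).
Qed.

HB.instance Definition _ := GRing.isZmodMorphism.Build C K fconst fconst_zmod.
HB.instance Definition _ := GRing.isMonoidMorphism.Build C K fconst fconst_monoid.

Definition subst2 (z : K * K) g : K := eval2 (map_poly (map_poly fconst) g) z.

Section Subst2.
Variable z : K * K.

Fact subst2_zmod : zmod_morphism (subst2 z).
Proof. by move=> g h; rewrite /subst2 rmorphB /eval2 !hornerD !hornerN. Qed.

Fact subst2_monoid : monoid_morphism (subst2 z).
Proof.
split; first by rewrite /subst2 rmorph1 /eval2 !hornerC.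
by move=> g h; rewrite /subst2 rmorphM /eval2 !hornerM.
Qed.

HB.instance Definition _ := GRing.isZmodMorphism.Build _ _ (subst2 z) subst2_zmod.
HB.instance Definition _ := GRing.isMonoidMorphism.Build _ _ (subst2 z)
  subst2_monoid.

Lemma subst2D g h : subst2 z (g + h) = subst2 z g + subst2 z h.
Proof. exact: rmorphD. Qed.

Lemma subst2N g : subst2 z (- g) = - subst2 z g.
Proof. exact: rmorphN. Qed.

Lemma subst2M g h : subst2 z (g * h) = subst2 z g * subst2 z h.
Proof. exact: rmorphM. Qed.

Lemma subst2_1 : subst2 z 1 = 1. Proof. exact: rmorph1. Qed.

Lemma subst2Xn g k : subst2 z (g ^+ k) = subst2 z g ^+ k.
Proof. exact: rmorphXn. Qed.

Lemma subst2X : subst2 z 'X = z.1.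
Proof. by rewrite /subst2 map_polyX /eval2 !hornerE. Qed.

Lemma subst2Y : subst2 z 'X%:P = z.2.
Proof. by rewrite /subst2 map_polyC /= map_polyX /eval2 !hornerE. Qed.

Lemma subst2C c : subst2 z c%:P%:P = fconst c.
Proof. by rewrite /subst2 !map_polyC /= map_polyC /eval2 !hornerE. Qed.
End Subst2.

Lemma poly2_ind (Q : {poly {poly C}} -> Prop) :
  (forall c, Q c%:P%:P) -> Q 'X -> Q 'X%:P ->
  (forall g h, Q g -> Q h -> Q (g + h)) ->
  (forall g h, Q g -> Q h -> Q (g * h)) -> forall g, Q g.
Proof.
move=> QC QX QY QD QM; elim/poly_ind => [|g d Qg]; first exact: (QC 0).
apply: (QD); first exact: (QM).
elim/poly_ind: d => [|d c Qd]; first exact: (QC 0).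
by rewrite polyCD polyCM; apply: (QD) => //; apply: (QM).
Qed.

Definition fpair p q : K := fpoly p + fpoly q * y.

Lemma fpairM p q r s :
  fpair p q * fpair r s = fpair (p * r + q * s * cubic) (p * s + q * r).
Proof.
rewrite /fpair; have := sqr_fy; move: cubic => c cE.
by rewrite !(fpolyD, fpolyM) -cE; ring.
Qed.

(** Reduction modulo y^2 = c(x) is carried out on functions and on values at once, so that units at
    an affine point can be described by pairs p + q y. *)
Lemma subst2_affine g : exists p q, subst2 (x, y) g = fpair p q /\
  forall x0 y0, y0 ^+ 2 = cubic.[x0] ->
    eval2 g (x0, y0) = p.[x0] + q.[x0] * y0.
Proof.
elim/poly2_ind: g => [c||||].
- exists c%:P, 0; rewrite subst2C /fpair fpoly0 mul0r addr0; split=> // x0 y0 _.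
  by rewrite /eval2 !hornerE.
- exists 'X, 0; rewrite subst2X /fpair fpoly0 mul0r addr0; split=> // x0 y0 _.
  by rewrite /eval2 !hornerE.
- exists 0, 1; rewrite subst2Y /fpair fpoly0 fpoly1 mul1r add0r; split=> //.
  by move=> x0 y0 _; rewrite /eval2 !hornerE.
- move=> g h [p [q [gE ge]]] [r [s [hE he]]]; exists (p + r), (q + s).
  rewrite subst2D gE hE /fpair !fpolyD; split; first by ring.
  move=> x0 y0 yE; move: (ge _ _ yE) (he _ _ yE).
  by rewrite /eval2 !hornerE => -> ->; ring.
- move=> g h [p [q [gE ge]]] [r [s [hE he]]].
  exists (p * r + q * s * cubic), (p * s + q * r).
  split; first by rewrite -fpairM -gE -hE; exact: subst2M.
  move=> x0 y0 yE.
  have -> : eval2 (g * h) (x0, y0) = eval2 g (x0, y0) * eval2 h (x0, y0).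
    by rewrite /eval2 !hornerM.
  rewrite (ge _ _ yE) (he _ _ yE); clear ge he.
  by move: cubic yE => k yE; rewrite !hornerD !hornerM -yE; ring.
Qed.

Lemma fpoly_subst2 p : subst2 (x, y) (map_poly polyC p) = fpoly p.
Proof.
elim/poly_ind: p => [|p c IH];
  first by rewrite fpoly0 map_poly0 /subst2 map_poly0 /eval2 !horner0.
rewrite rmorphD rmorphM /= map_polyX map_polyC subst2D subst2M IH subst2X.
by rewrite subst2C fpolyD fpolyM.
Qed.

Lemma fpair_subst2 p q : exists2 g, subst2 (x, y) g = fpair p q &
  forall x0 y0, eval2 g (x0, y0) = p.[x0] + q.[x0] * y0.
Proof.
exists (map_poly polyC p + map_poly polyC q * 'X%:P).
  by rewrite subst2D subst2M !fpoly_subst2 subst2Y.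
have E r (x0 : C) : (map_poly polyC r).[x0%:P] = r.[x0]%:P.
  by rewrite horner_map.
by move=> x0 y0; rewrite /eval2 /= !hornerD !hornerM !E !hornerE.
Qed.

Lemma fpair_neq0 p q x0 y0 : p.[x0] + q.[x0] * y0 != 0 -> fpair p q != 0.
Proof.
by apply: contra_neq => /fpoly_fy_eq0[-> ->]; rewrite !horner0 mul0r addr0.
Qed.

Lemma unit_at_affine P x0 y0 w : val P = Some (x0, y0) ->
  unit_at P w <-> exists p q r s, [/\ p.[x0] + q.[x0] * y0 != 0,
    r.[x0] + s.[x0] * y0 != 0 & w = fpair p q / fpair r s].
Proof.
move=> PE; have yE : y0 ^+ 2 = cubic.[x0].
  by have := valP P; rewrite PE /= => /eqP.
rewrite /unit_at /local_coords /local_values PE; split.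
  move=> [g [h [g0 h0 ->]]].
  have [p [q [gE ge]]] := subst2_affine g.
  have [r [s [hE he]]] := subst2_affine h.
  exists p, q, r, s; rewrite -ge // -he //; split=> //.
  by rewrite -gE -hE.
move=> [p [q [r [s [pq0 rs0 ->]]]]].
have [g gE ge] := fpair_subst2 p q; have [h hE he] := fpair_subst2 r s.
by exists g, h; rewrite ge he -gE -hE.
Qed.

(** * Units and orders at a point *)

Implicit Types (w f : K).

Lemma cubicE t : cubic.[t] = (a%:C - t) * (b%:C - t) * (beta%:C - t).
Proof. by rewrite /cubic !hornerE. Qed.

Lemma fpoly_eq0 p : (fpoly p == 0) = (p == 0).
Proof.
apply/eqP/eqP=> [|->]; last exact: fpoly0.
by move=> p0; apply: (fpoly_inj); rewrite p0 rmorph0.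
Qed.

Lemma fy_neq0 : y != 0.
Proof.
rewrite -sqrf_eq0 sqr_fy fpoly_eq0 -size_poly_eq0 size_cubic //.
Qed.

Lemma fx_subE (c : C) : x - fconst c = fpair ('X - c%:P) 0.
Proof. by rewrite /fpair fpoly0 mul0r addr0 fpolyD fpolyN. Qed.

Lemma uniformizer_neq0 P : uniformizer P != 0.
Proof.
rewrite /uniformizer; case: (val P) => [[x0 y0]|].
  case: ifP => _; first exact: fy_neq0.
  by rewrite fx_subE /fpair fpoly0 mul0r addr0 fpoly_eq0 polyXsubC_eq0.
by rewrite mulf_neq0 ?invr_eq0 ?fy_neq0 // (fpoly_eq0 'X) polyX_eq0.
Qed.

Lemma unit_at1 P : unit_at P 1.
Proof.
exists 1, 1; rewrite -/(subst2 _ _) subst2_1 divr1 /eval2 !hornerC oner_eq0.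
by split.
Qed.

Lemma unit_atM P w1 w2 : unit_at P w1 -> unit_at P w2 -> unit_at P (w1 * w2).
Proof.
move=> [g1 [h1 [g10 h10 ->]]] [g2 [h2 [g20 h20 ->]]].
exists (g1 * g2), (h1 * h2); split.
- by rewrite /eval2 !hornerM mulf_neq0.
- by rewrite /eval2 !hornerM mulf_neq0.
by rewrite -!/(subst2 _ _) !subst2M mulf_div.
Qed.

Lemma unit_atV P w : unit_at P w -> unit_at P w^-1.
Proof. by move=> [g [h [g0 h0 ->]]]; exists h, g; rewrite invf_div; split. Qed.

Lemma has_order0 P w : unit_at P w -> has_order P w 0.
Proof. by exists w => //; rewrite expr0z mul1r. Qed.

Lemma has_orderM P f1 f2 m1 m2 :
  has_order P f1 m1 -> has_order P f2 m2 -> has_order P (f1 * f2) (m1 + m2).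
Proof.
move=> [w1 U1 ->] [w2 U2 ->]; exists (w1 * w2); first exact: unit_atM.
by rewrite expfzDr ?uniformizer_neq0 // mulrACA.
Qed.

Lemma has_orderV P f m : has_order P f m -> has_order P f^-1 (- m).
Proof.
move=> [w U ->]; exists w^-1; first exact: unit_atV.
by rewrite invfM invr_expz.
Qed.

Lemma has_orderX P f m (k : nat) :
  has_order P f m -> has_order P (f ^+ k) (m * k%:Z).
Proof.
move=> H; elim: k => [|k IH]; first by rewrite mulr0 expr0;
  apply/has_order0/unit_at1.
by rewrite exprS -[k.+1]add1n PoszD mulrDr mulr1; apply: has_orderM.
Qed.

Lemma unit_at_fpair P x0 y0 p q : val P = Some (x0, y0) ->
  p.[x0] + q.[x0] * y0 != 0 -> unit_at P (fpair p q).
Proof.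
move=> PE pq0; apply/(unit_at_affine _ PE); exists p, q, 1, 0.
by rewrite /fpair fpoly1 fpoly0 mul0r addr0 divr1 !hornerE oner_eq0; split.
Qed.

(* The coordinates at infinity are X = x/y and Z = 1/y, where the curve is
   Z = (a Z - X)(b Z - X)(beta Z - X), that is Z (1 - q_inf) = - X^3. Hence
   x X^2 = y X^3 = q_inf - 1 is a unit at (0, 0). *)
Let A : {poly {poly C}} := (a%:C)%:P%:P.
Let B : {poly {poly C}} := (b%:C)%:P%:P.
Let D : {poly {poly C}} := (beta%:C)%:P%:P.
Let form (L : comNzRingType) (k1 k2 k3 t u : L) :=
  (k1 + k2 + k3) * (t * t) - (k1 * k2 + k1 * k3 + k2 * k3) * (t * u)
  + k1 * k2 * k3 * (u * u).
Let q_inf : {poly {poly C}} := form A B D 'X 'X%:P.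

Let X := x / y.
Let Z := y^-1.
Let sub_inf := subst2 (X, Z).

Let value_inf g := eval2 g (0 : C, 0 : C).
Let value_infM g h : value_inf (g * h) = value_inf g * value_inf h.
Proof. by rewrite /value_inf /eval2 !hornerM. Qed.
Let value_infD g h : value_inf (g + h) = value_inf g + value_inf h.
Proof. by rewrite /value_inf /eval2 !hornerD. Qed.
Let value_infN g : value_inf (- g) = - value_inf g.
Proof. by rewrite /value_inf /eval2 !hornerN. Qed.
Let value_infC c : value_inf c%:P%:P = c.
Proof. by rewrite /value_inf /eval2 !hornerC. Qed.
Let value_infX : value_inf 'X = 0.
Proof. by rewrite /value_inf /eval2 hornerX hornerC. Qed.
Let value_infY : value_inf 'X%:P = 0.
Proof. by rewrite /value_inf /eval2 hornerC hornerX. Qed.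

Let rho : K := x * X ^+ 2.

Let y2E : y ^+ 2 = (fconst a%:C - x) * (fconst b%:C - x) * (fconst beta%:C - x).
Proof. by rewrite sqr_fy /cubic !fpolyM !fpolyD !fpolyN. Qed.

Let rhoE : rho = sub_inf (q_inf - 1).
Proof.
have formE k1 k2 k3 t u : sub_inf (form k1 k2 k3 t u) =
    form (sub_inf k1) (sub_inf k2) (sub_inf k3) (sub_inf t) (sub_inf u).
  by rewrite /sub_inf /form !(subst2D, subst2N, subst2M).
rewrite /sub_inf subst2D subst2N subst2_1 -/sub_inf /q_inf formE.
rewrite /sub_inf subst2X subst2Y !subst2C /form /rho /X /Z /=.
exact: (chart_at_infinity fy_neq0 y2E).
Qed.

Let y3rho : y * X ^+ 3 = rho.
Proof.
by rewrite /rho /X exprS mulrA [y * _]mulrC divfK ?fy_neq0.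
Qed.

Let value_rho : value_inf (q_inf - 1) = -1.
Proof.
have formE k1 k2 k3 t u : value_inf (form k1 k2 k3 t u) =
    form (value_inf k1) (value_inf k2) (value_inf k3) (value_inf t) (value_inf u).
  by rewrite /form !(value_infD, value_infN, value_infM).
rewrite value_infD value_infN (value_infC 1) /q_inf formE.
by rewrite value_infX value_infY /form !mulr0 subr0 addr0 add0r.
Qed.

(** Horner's scheme: each factor x X^2 is [q_inf - 1], of value -1 at (0, 0), and the lower
    coefficients come with a power of X and disappear there. *)
Let poly_inf m p : (size p <= m.+1)%N -> exists2 g,
  sub_inf g = fpoly p * X ^+ (2 * m) & value_inf g = (-1) ^+ m * p`_m.
Proof.
elim: m p => [|m IH] p sp.
  exists (p`_0)%:P%:P; last by rewrite value_infC mul1r.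
  by rewrite {2}(size1_polyC sp) expr0 mulr1 /sub_inf subst2C.
have [p' [c pE]] : exists p' c, p = p' * 'X + c%:P.
  exists (drop_poly 1 p), p`_0; rewrite -{1}(poly_take_drop 1 p) expr1 addrC.
  by congr (_ + _); apply/polyP => -[|i]; rewrite coef_take_poly coefC.
have sp' : (size p' <= m.+1)%N.
  by move: sp; rewrite pE size_MXaddC; case: ifP => [/andP[/eqP->]|_] //;
    rewrite size_poly0.
have [g gE gv] := IH _ sp'.
exists (g * (q_inf - 1) + c%:P%:P * 'X ^+ (2 * m.+1)).
  rewrite /sub_inf subst2D !subst2M subst2C subst2Xn subst2X.
  rewrite -/sub_inf -rhoE gE pE fpolyD fpolyM /rho.
  rewrite -[fpoly 'X]/x -[fpoly c%:P]/(fconst c) mulnS [(X, Z).1]/=.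
  exact: chart_horner_step.
have V : value_inf ('X ^+ (2 * m.+1)) = 0.
  by rewrite mulnS addSn exprS value_infM value_infX mul0r.
rewrite value_infD !value_infM gv value_rho V mulr0 addr0.
by rewrite pE coefD coefMX coefC /= addr0 exprS mulrC mulrA.
Qed.

(** At infinity x has a pole of order 2 and y one of order 3, so q y has a pole of order at most 2m
    - 1 and p prevails. *)
Lemma has_order_inf P p q m : val P = None ->
  size p = m.+1 -> (size q <= m.-1)%N -> has_order P (fpair p q) (- (2 * m)%:Z).
Proof.
move=> PE sp sq.
have [g gE gv] : exists2 g, sub_inf g = fpair p q * X ^+ (2 * m) & value_inf g != 0.
  have [g gE gv] := poly_inf (eq_leq sp).
  have {}gv : value_inf g != 0.
    rewrite gv mulf_neq0 ?expf_neq0 ?oppr_eq0 ?oner_eq0 //.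
    have -> : m = (size p).-1 by rewrite sp.
    by rewrite -/(lead_coef p) lead_coef_eq0 -size_poly_eq0 sp.
  have [q0|q0] := eqVneq q 0.
    by exists g => //; rewrite gE q0 /fpair fpoly0 mul0r addr0.
  (* The bound on [size q] forces q = 0 when m is 0 or 1. *)
  case: m sp sq gE => [|[|m]] sp sq gE;
    try by rewrite leqn0 size_poly_eq0 (negPf q0) in sq.
  have [h hE _] := poly_inf sq.
  (* With the former m written as m + 2, q y X^(2m+4) = (q X^(2m)) (y X^3) X, and the last factor
     makes it vanish at (0, 0). *)
  exists (g + h * (q_inf - 1) * 'X).
    rewrite /sub_inf subst2D !subst2M subst2X -/sub_inf -rhoE gE hE -y3rho /fpair.
    by rewrite !mulnS; exact: chart_horner_step2.
  by rewrite value_infD !value_infM value_infX mulr0 addr0.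
have X0 : X != 0 by have := uniformizer_neq0 P; rewrite /uniformizer PE.
exists (sub_inf g).
  exists g, 1; rewrite /local_coords /local_values PE; split=> //.
    by rewrite /eval2 !hornerC oner_eq0.
  by rewrite -!/(subst2 _ _) subst2_1 divr1.
rewrite gE /uniformizer PE -/X mulrCA -exprnN mulVf ?mulr1 //.
by rewrite expf_neq0.
Qed.

(** * Orders of p + q y over x = 0 and at Q_b *)

Lemma fpair_norm p q :
  fpair p q * fpair p (- q) = fpoly (p ^+ 2 - cubic * q ^+ 2).
Proof.
rewrite fpairM; move: cubic => k.
rewrite [p * - q + _](_ : _ = 0); last by ring.
rewrite /fpair fpoly0 mul0r addr0; congr fpoly; ring.
Qed.

Lemma fpair0E p : fpair p 0 = fpoly p.
Proof. by rewrite /fpair fpoly0 mul0r addr0. Qed.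

Lemma uniformizer_x P y0 : val P = Some (0, y0) -> y0 != 0 -> uniformizer P = x.
Proof.
by rewrite /uniformizer => -> /negPf ->; rewrite fx_subE fpair0E subr0.
Qed.

(** p + q y is its norm x^n N divided by the conjugate p - q y, and both N and the conjugate are
    units at P. *)
Lemma has_order_Q0 P p q n N y0 : val P = Some (0, y0) -> y0 != 0 ->
  p ^+ 2 - cubic * q ^+ 2 = 'X^n * N -> N.[0] != 0 ->
  p.[0] - q.[0] * y0 != 0 -> has_order P (fpair p q) n%:Z.
Proof.
move=> PE y00 pqN N0 pq0.
have pq0' : p.[0] + (- q).[0] * y0 != 0 by rewrite hornerN mulNr.
exists (fpair N 0 / fpair p (- q)).
  apply/(unit_at_affine _ PE); exists N, 0, p, (- q).
  by rewrite horner0 mul0r addr0; split.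
rewrite (uniformizer_x PE) // mulrA; 
have D0 : fpair p (- q) != 0 by apply: fpair_neq0 pq0'.
apply: (canRL (mulfK D0)).
rewrite fpair_norm pqN fpair0E fpolyM; congr (_ * _); exact: rmorphXn.
Qed.

Lemma cubic_split_b : cubic = ('X - b%:C%:P) * - (((a%:C)%:P - 'X) *
  ((beta%:C)%:P - 'X)).
Proof. by rewrite /cubic; ring. Qed.

Section AtQb.
Hypotheses (ab : a != b) (bb : b != beta).
(** The cofactor of x - b in the cubic. It does not vanish at Q_b, where y is the uniformizer and x
    - b = y^2 / k. *)
Let k : {poly C} := - (((a%:C)%:P - 'X) * ((beta%:C)%:P - 'X)).
Let kb : k.[b%:C] != 0.
Proof.
rewrite /k hornerN oppr_eq0 hornerM !hornerD !hornerN !hornerC !hornerX.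
by rewrite mulf_neq0 // -rmorphB fmorph_eq0 subr_eq0 // eq_sym.
Qed.
Let kE : y ^+ 2 = fpoly ('X - b%:C%:P) * fpoly k.
Proof. by rewrite -fpolyM -cubic_split_b sqr_fy. Qed.
Let k0 : fpoly k != 0.
Proof. by rewrite fpoly_eq0; apply: contra_neq kb => ->; rewrite horner0. Qed.

(** (x - b) p + q y = y (q k + p y) / k, and q k + p y takes the value q(b) k(b) at Q_b. *)
Lemma has_order_Qb p q : q.[b%:C] != 0 ->
  has_order (Qb a b beta) (fpair (('X - b%:C%:P) * p) q) 1.
Proof.
move=> qb; exists (fpair (q * k) p / fpair k 0).
  apply/(unit_at_affine (x0 := b%:C) (y0 := 0)) => //.
  by exists (q * k), p, k, 0; rewrite !mulr0 !addr0 hornerM mulf_neq0.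
rewrite expr1z /uniformizer /= eqxx mulrA fpair0E; apply: (canRL (mulfK k0)).
rewrite /fpair !fpolyM.
have -> u1 u2 u3 (u4 u5 : K) : (u1 * u2 + u3 * u4) * u5
   = u1 * u5 * u2 + u3 * u5 * u4 by rewrite !(mulrDl, mulrA) -!mulrA [u2 *
     _]mulrC [u4 * _]mulrC.
by rewrite -kE mulrDr addrC mulrC expr2 -mulrA [y * (fpoly p)]mulrC.
Qed.

Lemma has_order_Qb_sub : has_order (Qb a b beta) (fpoly ('X - b%:C%:P)) 2.
Proof.
exists (fpair 1 0 / fpair k 0).
  apply/(unit_at_affine (x0 := b%:C) (y0 := 0)) => //.
  by exists 1, 0, k, 0; rewrite !mulr0 !addr0 hornerC oner_eq0.
rewrite /uniformizer /= eqxx !fpair0E fpoly1 mul1r -[y ^ 2]/(y ^+ 2) kE mulfK //.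
Qed.
End AtQb.

(** * Functions regular on the affine curve *)

Lemma fpair_inj p q r s : fpair p q = fpair r s -> p = r /\ q = s.
Proof.
move=> /eqP; rewrite -subr_eq0 /fpair opprD addrACA -mulrBl -!fpolyN -!fpolyD.
by move=> /eqP /fpoly_fy_eq0[/eqP + /eqP]; rewrite !subr_eq0 => /eqP-> /eqP->.
Qed.

Lemma fpair_pow_closed (u : K) m p q : (exists r s, u = fpair r s) ->
  exists p' q', u ^+ m * fpair p q = fpair p' q'.
Proof.
move=> [r [s uE]].
elim: m => [|m [p' [q' IH]]].
  exists p, q.
  exact: mul1r.
exists (r * p' + s * q' * cubic), (r * q' + s * p').
rewrite exprS -mulrA IH uE.
exact: fpairM.
Qed.

Lemma uniformizer_fpair P x0 y0 : val P = Some (x0, y0) ->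
  exists r s, uniformizer P = fpair r s.
Proof.
rewrite /uniformizer => ->; case: ifP => _.
  by exists 0, 1; rewrite /fpair fpoly0 fpoly1 mul1r add0r.
by exists ('X - x0%:P), 0; rewrite fx_subE.
Qed.

(** Clearing the denominator of the unit turns an order into an identity between pairs p + q y. *)
Lemma has_order_fraction P x0 y0 f (m : nat) : val P = Some (x0, y0) ->
  has_order P f m%:Z -> exists p q r s, [/\ p.[x0] + q.[x0] * y0 != 0,
    r.[x0] + s.[x0] * y0 != 0 & f * fpair r s = uniformizer P ^+ m * fpair p q].
Proof.
move=> PE [w /(unit_at_affine _ PE)[p [q [r [s [pq0 rs0 ->]]]]] ->].
have rs : fpair r s != 0 by apply: fpair_neq0 rs0.
by exists p, q, r, s; split; [| |rewrite mulrA (divfK rs)].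
Qed.

Lemma eval_fpairM x0 y0 p q r s t u : y0 ^+ 2 = cubic.[x0] ->
  fpair p q * fpair r s = fpair t u ->
  (p.[x0] + q.[x0] * y0) * (r.[x0] + s.[x0] * y0) = t.[x0] + u.[x0] * y0.
Proof.
move=> yE; rewrite fpairM => /fpair_inj[<- <-].
by move: cubic yE => k yE; rewrite !hornerD !hornerM -yE; ring.
Qed.

Definition curve_point x0 y0 (yE : on_curve a b beta (Some (x0, y0))) : point :=
  Sub (Some (x0, y0)) yE.

(** Induction on the degree of the denominator r. At a root x0 of r, regularity at every point above
    x0 forces p and q to vanish at x0 as well, and x - x0 cancels. *)
Lemma regular_polynomial f :
  (forall P x0 y0, val P = Some (x0, y0) -> exists m : nat, has_order P f m%:Z) ->
  exists p q, f = fpair p q.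
Proof.
move=> reg.
have [p [q [r [r0 fE]]]] := function_fieldE f.
have [n] := ubnP (size r); elim: n => // n IH in p q r r0 fE *; rewrite ltnS => sr.
have [r1|/closed_rootP[x0 rx0]] := eqVneq (size r) 1%N.
  have [c c0 rE] := size_poly1P _ (introT eqP r1).
  have c0' : fpoly c%:P != 0 by rewrite fpoly_eq0 -rE.
  exists (c^-1%:P * p), (c^-1%:P * q); apply: (mulfI c0').
  have ce t : fpoly c%:P * fpoly (c^-1%:P * t) = fpoly t.
    by rewrite -fpolyM mulrA -polyCM mulfV // mul1r.
  by rewrite -rE fE rE /fpair mulrDr ce mulrA ce.
(* A denominator u + v y of f at a point above x0 gives (p + q y)(u + v y) = r (s' + t' y), and both
   components on the right vanish at x0. *)
have val_pq y0 : y0 ^+ 2 = cubic.[x0] -> exists u v,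
    [/\ u.[x0] + v.[x0] * y0 != 0, (p.[x0] + q.[x0] * y0) = 0
      & p.[x0] * v.[x0] + q.[x0] * u.[x0] = 0].
  move=> /eqP yE; have PE : val (@curve_point x0 y0 yE) = Some (x0, y0) by [].
  have [m /(has_order_fraction PE)[s [t [u [v [_ uv0 uvE]]]]]] := reg _ _ _ PE.
  have [s' [t' stE]] := fpair_pow_closed m s t (uniformizer_fpair PE).
  have E : fpair p q * fpair u v = fpair (r * s') (r * t').
    rewrite -[fpair p q]fE -mulrA uvE stE /fpair !fpolyM mulrDr !mulrA.
    by [].
  exists u, v; split; first exact: uv0.
    have := eval_fpairM (eqP yE) E; rewrite !hornerM (eqP rx0) !mul0r addr0.
    by move=> /eqP; rewrite mulf_eq0 (negPf uv0) orbF => /eqP.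
  move: E; rewrite fpairM => /fpair_inj[_ E].
  by rewrite -!hornerM -hornerD E hornerM (eqP rx0) mul0r.
have [p0 q0] : p.[x0] = 0 /\ q.[x0] = 0.
  have yE := sqrtCK cubic.[x0]; set y0 := sqrtC _ in yE.
  have [u [v [uv0 pq0 pvqu]]] := val_pq _ yE.
  (* At a branch point p(x0) = 0 comes from the value and q(x0) = 0 from the y-component; otherwise
     the points (x0, y0) and (x0, - y0) are compared. *)
  have [y00|y00] := eqVneq y0 0.
    move: uv0 pq0; rewrite y00 !mulr0 !addr0 => u0 p0; split=> //.
    by move/eqP: pvqu; rewrite p0 mul0r add0r mulf_eq0 (negPf u0) orbF => /eqP.
  have [|_ [_ [_ pq0' _]]] := val_pq (- y0); first by rewrite sqrrN.
  have p0 : p.[x0] = 0.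
    apply: (mulfI (_ : 2%:R != 0 :> C)); rewrite ?pnatr_eq0 // mulr0.
    by rewrite -[RHS]addr0 -{1}pq0 -pq0'; ring.
  split=> //; move/eqP: pq0; rewrite p0 add0r mulf_eq0 (negPf y00) orbF.
  by move=> /eqP.
have /factor_theorem[p' pE] : root p x0 by apply/eqP.
have /factor_theorem[q' qE] : root q x0 by apply/eqP.
have /factor_theorem[r' rE] := rx0.
have r'0 : r' != 0 by apply: contraNneq r0 => r'0; rewrite rE r'0 mul0r.
have X0 : fpoly ('X - x0%:P) != 0 by rewrite fpoly_eq0 polyXsubC_eq0.
have fE' : fpoly r' * f = fpoly p' + fpoly q' * y.
  apply: (mulfI X0); rewrite mulrA [_ * fpoly r']mulrC -fpolyM -rE fE pE qE !fpolyM.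
  by rewrite mulrDr mulrA ![_ * fpoly ('X - _)]mulrC.
apply: (IH p' q' r' r'0 fE').
by move: sr; rewrite rE size_Mmonic ?monicXsubC // size_XsubC addn2.
Qed.

(** * Values and norms recovered from orders *)

Lemma has_order0_eval P x0 y0 p q : val P = Some (x0, y0) ->
  has_order P (fpair p q) 0 -> p.[x0] + q.[x0] * y0 != 0.
Proof.
move=> PE /(has_order_fraction (m := 0) PE)[s [t [u [v [st0 uv0]]]]].
rewrite expr0 mul1r => E.
have yE : y0 ^+ 2 = cubic.[x0] by have := valP P; rewrite PE /= => /eqP.
by move: st0; rewrite -(eval_fpairM yE E) mulf_eq0 negb_or => /andP[].
Qed.

Lemma has_order_Q0_eval P y0 p q n : val P = Some (0, y0) -> y0 != 0 ->
  (0 < n)%N -> has_order P (fpair p q) n%:Z -> p.[0] + q.[0] * y0 = 0.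
Proof.
move=> PE y00 n0 /(has_order_fraction PE)[s [t [u [v [_ uv0]]]]].
rewrite (uniformizer_x PE y00) -[x]/(fpoly 'X) -fpolyXn => E.
have {}E : fpair p q * fpair u v = fpair ('X^n * s) ('X^n * t).
  by rewrite E /fpair mulrDr mulrA -!fpolyM.
have yE : y0 ^+ 2 = cubic.[0] by have := valP P; rewrite PE /= => /eqP.
have /eqP := eval_fpairM yE E; rewrite !hornerM hornerXn expr0n gtn_eqF //.
by rewrite !mul0r addr0 mulf_eq0 (negPf uv0) orbF => /eqP.
Qed.

(** Multiplying by the conjugate turns the order into M (u + v y) = x^n (s' + t' y) with neither
    factor in brackets vanishing at P, so x divides the norm M exactly n times. *)
Lemma has_order_Q0_norm P y0 p q n : val P = Some (0, y0) -> y0 != 0 ->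
  p.[0] - q.[0] * y0 != 0 -> has_order P (fpair p q) n%:Z ->
  exists2 N, p ^+ 2 - cubic * q ^+ 2 = 'X^n * N & N.[0] != 0.
Proof.
move=> PE y00 pq0 /(has_order_fraction PE)[s [t [u [v [st0 uv0]]]]].
rewrite (uniformizer_x PE y00) -[x]/(fpoly 'X) -fpolyXn => E.
have yE : y0 ^+ 2 = cubic.[0] by have := valP P; rewrite PE /= => /eqP.
have := fpair_norm p q; move: (p ^+ 2 - _) => M ME.
have [s' [t' stE]] : exists s' t', fpair s t * fpair p (- q) = fpair s' t'.
  by eexists; eexists; exact: fpairM.
have st'0 : s'.[0] + t'.[0] * y0 != 0.
  rewrite -(eval_fpairM yE stE); apply: mulf_neq0; first exact: st0.
  by rewrite hornerN mulNr.
have {stE}E : fpair (M * u) (M * v) = fpair ('X^n * s') ('X^n * t').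
  have F (w1 w2 w3 : {poly C}) : fpair (w1 * w2) (w1 * w3) = fpoly w1 * fpair w2 w3.
    by rewrite /fpair !fpolyM mulrDr mulrA.
  have G (k1 k2 k3 k4 k5 k6 k7 : K) : k1 * k3 = k4 * k5 -> k1 * k2 = k6 ->
    k5 * k2 = k7 -> k6 * k3 = k4 * k7.
    by move=> kE <- <-; rewrite mulrAC kE mulrA.
  apply: etrans (F M u v) _; apply: etrans (esym (F 'X^n s' t')).
  exact: G E ME stE.
have [Mu Mv] := fpair_inj E.
have M0 : M != 0.
  apply: contraNneq st'0 => M0; move: Mu Mv;
    rewrite M0 !mul0r => /esym/eqP + /esym/eqP.
  by rewrite !mulf_eq0 expf_eq0 polyX_eq0 andbF /= => /eqP-> /eqP->;
    rewrite !horner0 mul0r addr0.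
have [k [N N0 {}ME]] := multiplicity_XsubC M 0.
rewrite M0 subr0 in N0 ME.
(* Here M = N x^k. If k < n, then x would divide N (u + v y), whose value at P is nonzero; otherwise
   M / x^n is x^(k - n) N and must not vanish at 0. *)
have [kn|nk] := ltnP k n.
  case/eqP: (mulf_neq0 N0 uv0); rewrite mulrDr mulrA -!hornerM.
  have F (w1 w2 : {poly C}) : M * w1 = 'X^n * w2 -> (N * w1).[0] = 0.
    move=> MwE; rewrite (cancel_Xn (ltnW kn) ME MwE) hornerM hornerXn expr0n.
    by rewrite subn_eq0 leqNgt kn mul0r.
  by rewrite (F _ _ Mu) (F _ _ Mv) mul0r addr0.
exists ('X^(k - n) * N).
  by apply: etrans ME _; rewrite [RHS]mulrA -exprD (subnKC nk); exact: mulrC.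
have F (w1 w2 : {poly C}) : M * w1 = 'X^n * w2 -> 'X^(k - n) * N * w1 = w2.
  exact: cancel_Xn_ge nk ME.
apply: contraNneq st'0 => kN0.
by rewrite -(F _ _ Mu) -(F _ _ Mv) hornerM [X in _ + X * _]hornerM kN0 !mul0r addr0.
Qed.

(** (p + q y)(u + v y) = y (s + t y) = t c + s y; the two components are compared at x = b, where c
    vanishes. *)
Lemma has_order_Qb_eval p q : has_order (Qb a b beta) (fpair p q) 1 ->
  p.[b%:C] = 0 /\ q.[b%:C] != 0.
Proof.
have PE : val (Qb a b beta) = Some (b%:C, 0) by [].
move=> /(has_order_fraction (m := 1) PE)[s [t [u [v []]]]].
rewrite !mulr0 !addr0 expr1 /uniformizer /= eqxx => s0 u0 E.
have c0 : cubic.[b%:C] = 0 by rewrite cubicE subrr mulr0 mul0r.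
have {}E : fpair p q * fpair u v = fpair (t * cubic) s.
  rewrite E /fpair mulrDr fpolyM -sqr_fy expr2 mulrA.
  by rewrite [RHS]addrC [y * fpoly s]mulrC [y * fpoly t]mulrC mulrA.
move: E; rewrite fpairM => /fpair_inj[E1 E2].
have p0 : p.[b%:C] = 0.
  have := congr1 (horner^~ b%:C) E1; move: cubic c0 => k k0.
  rewrite !(hornerD, hornerM) k0 !mulr0 addr0 => /eqP.
  by rewrite mulf_eq0 (negPf u0) orbF => /eqP.
split=> //; apply: contraNneq s0 => q0.
by rewrite -E2 hornerD !hornerM p0 q0 !mul0r addr0.
Qed.

End FunctionField.

(** * Pell's equation *)

Section NormSize.
Variable F : fieldType.
Implicit Types p q c M : {poly F}.

Lemma even_size_sqr p : p != 0 -> size (p ^+ 2) = (size p).*2.-1.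
Proof. by move=> p0; rewrite expr2 size_mul // addnn. Qed.

(** p^2 has even degree and c q^2 odd degree, so their leading terms never cancel, and a norm of
    even degree 2m takes its leading term from p^2. *)
Lemma norm_size c p q m : size c = 4%N ->
  size (p ^+ 2 - c * q ^+ 2) = (2 * m).+1 ->
  [/\ size p = m.+1, (size q <= m.-1)%N & (size (c * q ^+ 2)%R <= 2 * m)%N].
Proof.
move=> sc sM; have c0 : c != 0 by rewrite -size_poly_eq0 sc.
have [q0|q0] := eqVneq q 0.
  rewrite q0 size_poly0 expr0n mulr0 size_poly0; split=> //.
  have p0 : p != 0 by apply: contra_eq_neq sM => ->;
    rewrite q0 !expr0n mulr0 subr0 size_poly0.
  move: sM; rewrite q0 expr0n mulr0 subr0 even_size_sqr //.
  by move: p0; rewrite -size_poly_gt0; lia.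
have scq : size (c * q ^+ 2) = ((size q).*2 + 2)%N.
  rewrite size_mul ?expf_neq0 // sc even_size_sqr //.
  by move: q0; rewrite -size_poly_gt0; lia.
have sq : (0 < size q)%N by rewrite size_poly_gt0.
rewrite scq; have [p0|p0] := eqVneq p 0.
  by move: sM; rewrite p0 expr0n sub0r size_polyN scq; lia.
have sp : (0 < size p)%N by rewrite size_poly_gt0.
have [lt|ge] := ltnP (size (p ^+ 2)) (size (- (c * q ^+ 2))).
  by move: sM; rewrite addrC size_polyDl // size_polyN scq; lia.
have lt : (size (- (c * q ^+ 2))%R < size (p ^+ 2)%R)%N.
  by move: ge; rewrite size_polyN scq even_size_sqr //; lia.
have := sM; rewrite size_polyDl // even_size_sqr // => sp2.
by move: lt; rewrite size_polyN scq even_size_sqr //; split; lia.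
Qed.

End NormSize.

Section Squares.
Variable F : numClosedFieldType.
Implicit Types p q r : {poly F}.

(** Induction on the degree: a root of p is a root of r, hence at least a double root of p q = r^2,
    and then of p, since q does not vanish there. *)
Lemma coprime_factor_square p q r : p != 0 ->
  (forall z, root p z -> ~~ root q z) -> p * q = r ^+ 2 -> exists s, p = s ^+ 2.
Proof.
have [n] := ubnP (size p); elim: n => // n IH in p r *; rewrite ltnS => sp p0 pq E.
have [p1|/closed_rootP[z pz]] := eqVneq (size p) 1%N.
  have [c _ ->] := size_poly1P _ (introT eqP p1).
  by exists (sqrtC c)%:P; rewrite -polyC_exp sqrtCK.
have /factor_theorem[r' rE] : root r z.
  by rewrite /root -sqrf_eq0 -horner_exp -E hornerM mulf_eq0 -!rootE pz.
have X0 : 'X - z%:P != 0 :> {poly F} by rewrite polyXsubC_eq0.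
have /factor_theorem[p' pE] := pz.
have E' : p' * q = r' ^+ 2 * ('X - z%:P).
  by apply: (mulfI X0); rewrite mulrA [_ * p']mulrC -pE E rE; ring.
have : root (p' * q) z by rewrite E' rootM root_XsubC eqxx orbT.
rewrite rootM (negPf (pq _ pz)) orbF => /factor_theorem[p'' p'E].
have p''0 : p'' != 0.
  by apply: contraNneq p0 => p''0; rewrite pE p'E p''0 !mul0r.
have [||||s sE] := IH p'' r'.
- apply: leq_trans sp; rewrite pE p'E !size_Mmonic ?monicXsubC ?mulf_neq0 //.
  by rewrite !size_XsubC !addn2.
- by [].
- by move=> x px; apply: pq; rewrite pE p'E !rootM px.
- by apply: (mulIf X0); rewrite -E' p'E; ring.
by exists (s * ('X - z%:P)); rewrite pE p'E sE; ring.
Qed.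

End Squares.

Definition cub (F : nzRingType) (a b beta : F) : {poly F} :=
  (a%:P - 'X) * (b%:P - 'X) * (beta%:P - 'X).

Lemma horner_cub (F : comNzRingType) (a b beta x : F) :
  (cub a b beta).[x] = (a - x) * (b - x) * (beta - x).
Proof. by rewrite /cub !hornerE. Qed.

Lemma size_cub (F : idomainType) (a b beta : F) : size (cub a b beta) = 4%N.
Proof.
have E (u : F) : u%:P - 'X = - ('X - u%:P) by rewrite opprB.
rewrite /cub !E mulrNN mulrN size_polyN.
by rewrite !size_mul ?mulf_neq0 ?polyXsubC_eq0 // !size_XsubC.
Qed.

(* In terms of the function f = A + B y on the curve y^2 = c(x): f has divisor
   2n(Q_0 - Q_oo), and its values at Q_a and Q_b fix its class modulo squares. *)
Definition pell_solution (F : fieldType) (a b beta y0 : F) n (A B : {poly F}) :=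
  [/\ A \is monic, A ^+ 2 - cub a b beta * B ^+ 2 = 'X^(2 * n),
      A.[0] + B.[0] * y0 = 0 & [/\ A.[0] != 0, A.[a] = a ^+ n &
      A.[b] = (- b) ^+ n]].

Lemma pell_size (F : fieldType) (a b beta y0 : F) n (A B : {poly F}) :
  pell_solution a b beta y0 n A B -> size A = n.+1 /\ (size B <= n.-1)%N.
Proof.
move=> [_ N _ _]; have [||sA sB _] := @norm_size _ (cub a b beta) A B n.
- exact: size_cub.
- by rewrite N size_polyXn.
by [].
Qed.

(** * Passing between A + B y and its square root up to factors of c *)

Section Pell.
Variable F : numClosedFieldType.
Variables a b beta y0 : F.
Hypotheses (ab : a != b) (a_beta : a != beta) (b_beta : b != beta).
Hypothesis b0 : b != 0.
Hypothesis y0E : y0 ^+ 2 = a * b * beta.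
Local Notation c := (cub a b beta).
Implicit Types (n : nat) (A B p q r s : {poly F}).

Let cubE t : c.[t] = (a - t) * (b - t) * (beta - t).
Proof. exact: horner_cub. Qed.

Lemma factor2 p u v : u != v -> root p u -> root p v ->
  exists q, p = ('X - u%:P) * ('X - v%:P) * q.
Proof.
move=> uv pu pv; have /dvdpP[q ->] : ('X - u%:P) * ('X - v%:P) %| p.
  have := @uniq_roots_dvdp _ p [:: u; v]; rewrite uniq_rootsE /= pu pv inE uv.
  by rewrite !big_cons big_nil mulr1; apply.
by exists q; rewrite mulrC.
Qed.

Lemma factor3 p u v w : u != v -> u != w -> v != w ->
  root p u -> root p v -> root p w ->
  exists q, p = ('X - u%:P) * ('X - v%:P) * ('X - w%:P) * q.
Proof.
move=> uv uw vw pu pv pw.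
have /dvdpP[q ->] : ('X - u%:P) * ('X - v%:P) * ('X - w%:P) %| p.
  have := @uniq_roots_dvdp _ p [:: u; v; w].
  rewrite uniq_rootsE /= pu pv pw !inE (negPf uv) uw vw.
  by rewrite !big_cons big_nil mulr1 mulrA; apply.
by exists q; rewrite mulrC.
Qed.

(** From (A - x^n)(A + x^n) = c B^2 it follows that p q = B^2. A common root of p and q would be a
    root of both x^n and A, which is excluded as A(0) is nonzero. *)
Lemma pell_split n A B c1 c2 p q : (0 < n)%N -> A.[0] != 0 ->
  A ^+ 2 - c * B ^+ 2 = 'X^(2 * n) -> c1 * c2 = c ->
  A - 'X^n = c1 * p -> A + 'X^n = c2 * q ->
  (exists r, A - 'X^n = c1 * r ^+ 2) /\ (exists r, A + 'X^n = c2 * r ^+ 2).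
Proof.
move=> n0 A0 AB cE Ap Aq.
have c0 : c != 0 by rewrite -size_poly_eq0 size_cub.
have pq : p * q = B ^+ 2.
  apply: (mulfI c0); rewrite -{1}cE mulrACA -Ap -Aq.
  have -> : c * B ^+ 2 = A ^+ 2 - 'X^(2 * n) by rewrite -AB; ring.
  by rewrite mulnC exprM; ring.
have cop z : root p z -> ~~ root q z.
  move=> /rootP pz; apply/negP => /rootP qz.
  have := congr1 (horner^~ z) Ap; have := congr1 (horner^~ z) Aq.
  rewrite !hornerM pz qz !mulr0 !hornerE => /eqP + /eqP.
  rewrite addr_eq0 subr_eq0 => /eqP Az; rewrite Az eq_sym -addr_eq0 -mulr2n.
  rewrite mulrn_eq0 /= expf_eq0 n0 /= => /eqP z0; move: Az A0; rewrite z0 expr0n.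
  by rewrite gtn_eqF //= oppr0 => ->; rewrite eqxx.
have p0 : p != 0.
  apply: contraNneq A0 => p0; move/eqP: Ap; rewrite p0 mulr0 subr_eq0 => /eqP->.
  by rewrite hornerXn expr0n gtn_eqF.
have q0 : q != 0.
  apply: contraNneq A0 => q0; move/eqP: Aq; rewrite q0 mulr0 addr_eq0 => /eqP->.
  by rewrite hornerN hornerXn expr0n gtn_eqF // oppr0.
have [s sE] := coprime_factor_square p0 cop pq.
have [|t tE] := coprime_factor_square q0 (q := p) (r := B) _ (etrans (mulrC _
  _) pq).
  by move=> z qz; apply/negP => /cop; rewrite qz.
by split; [exists s; rewrite Ap sE | exists t; rewrite Aq tE].
Qed.

Section Signs.
Variables (n : nat) (A B : {poly F}).
Hypotheses (n0 : (0 < n)%N) (AB : pell_solution a b beta y0 n A B).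

Let size_plus : size (A + 'X^n) = n.+1.
Proof.
have [/monicP lA _ _ _] := AB; have [sA _] := pell_size AB.
apply/eqP; rewrite eqn_leq; apply/andP; split.
  by rewrite (leq_trans (size_polyD _ _)) // sA size_polyXn maxnn.
apply: contraT; rewrite -leqNgt => /leq_sizeP/(_ n (leqnn n))/eqP.
rewrite coefD coefXn eqxx -[A`_n](_ : lead_coef A = _);
  last by rewrite /lead_coef sA.
by rewrite lA -mulr2n pnatr_eq0.
Qed.

Let A_beta : A.[beta] = beta ^+ n \/ A.[beta] = - beta ^+ n.
Proof.
have [_ N _ _] := AB; have := congr1 (horner^~ beta) N.
rewrite hornerD hornerN (hornerM c) cubE subrr mulr0 mul0r subr0 hornerXn
  horner_exp.
by rewrite mulnC exprM => /eqP; rewrite eqf_sqr => /orP[]/eqP; [left|right].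
Qed.

Let size_even_sqr r : r != 0 -> odd (size (r ^+ 2)).
Proof.
move=> r0; rewrite even_size_sqr //; move: r0; rewrite -size_poly_gt0.
by case: (size r) => // k _; rewrite doubleS /= odd_double.
Qed.

(** The sign of A at beta decides. If A(beta) = beta^n, all of c divides A - x^n and A + x^n is a
    square. The other sign would give A + x^n = (beta - x) r^2, of odd degree. *)
Lemma pell_even : ~~ odd n -> exists p q, p ^+ 2 - c * q ^+ 2 = 2%:P * 'X^n /\
  p.[0] ^+ 2 = A.[0].
Proof.
move=> ev; have [_ N _ [A0 Aa Ab]] := AB.
have ra : root (A - 'X^n) a by rewrite /root !hornerE Aa subrr.
have rb : root (A - 'X^n) b by rewrite /root !hornerE Ab exprNn -signr_odd
  (negPf ev) mul1r subrr.
case: A_beta => Abeta.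
  have rbeta : root (A - 'X^n) beta by rewrite /root !hornerE Abeta subrr.
  have [p pE] := factor3 ab a_beta b_beta ra rb rbeta.
  have [] := @pell_split n A B c 1 (- p) (A + 'X^n) n0 A0 N.
  - by rewrite mulr1.
  - by rewrite pE /cub; ring.
  - by rewrite mul1r.
  move=> [s sE] [t tE]; exists t, s; split.
    by rewrite -[t ^+ 2]mul1r -tE -sE; ring.
  by rewrite -horner_exp -[t ^+ 2]mul1r -tE !hornerE expr0n gtn_eqF // addr0.
have rbeta : root (A + 'X^n) beta by rewrite /root !hornerE Abeta addNr.
have [p pE] := factor2 ab ra rb; have /factor_theorem[q qE] := rbeta.
have [] := @pell_split n A B (('X - a%:P) * ('X - b%:P)) (beta%:P - 'X) p (- q)
  n0 A0 N.
- by rewrite /cub; ring.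
- exact: pE.
- by rewrite qE; ring.
move=> _ [r rE]; have := size_plus; rewrite rE.
have X0 : beta%:P - 'X != 0 :> {poly F} by rewrite -opprB oppr_eq0 polyXsubC_eq0.
have r0 : r != 0.
  by apply: contra_eq_neq size_plus => r0; rewrite rE r0 expr0n mulr0 size_poly0.
rewrite size_mul ?expf_neq0 // -[size (_ - 'X)]size_polyN opprB size_XsubC.
by rewrite add2n => -[sn]; move: (size_even_sqr r0); rewrite sn (negPf ev).
Qed.

(** Now A + x^n vanishes at b. If A(beta) = beta^n, then A + x^n = (x - b) p^2 and A - x^n = - (x -
    a)(x - beta) q^2; the other sign would give A + x^n = (x - b)(x - beta) r^2, of even degree. *)
Lemma pell_odd : odd n -> exists p q,
  ('X - b%:P) * p ^+ 2 + ('X - a%:P) * ('X - beta%:P) * q ^+ 2 = 2%:P * 'X^n /\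
  - b * p.[0] ^+ 2 = A.[0].
Proof.
move=> od; have [_ N _ [A0 Aa Ab]] := AB.
have ra : root (A - 'X^n) a by rewrite /root !hornerE Aa subrr.
have rb : root (A + 'X^n) b by rewrite /root !hornerE Ab exprNn -signr_odd od
  mulN1r addNr.
have [q qE] := factor_theorem _ _ rb.
case: A_beta => Abeta.
  have rbeta : root (A - 'X^n) beta by rewrite /root !hornerE Abeta subrr.
  have [p pE] := factor2 a_beta ra rbeta.
  have [] := @pell_split n A B (- (('X - a%:P) * ('X - beta%:P))) ('X - b%:P)
    (- p) q n0 A0 N.
  - by rewrite /cub; ring.
  - by rewrite pE; ring.
  - by rewrite qE mulrC.
  move=> [s sE] [t tE]; exists t, s; split.
    by rewrite -tE -[X in _ + X]opprK -mulNr -sE; ring.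
  rewrite -horner_exp; have := congr1 (horner^~ 0) tE.
  by rewrite hornerD hornerXn expr0n gtn_eqF // addr0 hornerM hornerXsubC sub0r.
have rbeta : root (A + 'X^n) beta by rewrite /root !hornerE Abeta addNr.
have [p pE] := factor2 b_beta rb rbeta; have /factor_theorem[q' qE'] := ra.
have [] := @pell_split n A B (a%:P - 'X) (('X - b%:P) * ('X - beta%:P)) (- q')
  p n0 A0 N.
- by rewrite /cub; ring.
- by rewrite qE'; ring.
- exact: pE.
move=> _ [r rE]; have := size_plus; rewrite rE.
have r0 : r != 0.
  by apply: contra_eq_neq size_plus => r0; rewrite rE r0 expr0n mulr0 size_poly0.
rewrite size_mul ?mulf_neq0 ?expf_neq0 ?polyXsubC_eq0 //.
rewrite [size (_ * ('X - _))]size_mul ?polyXsubC_eq0 // !size_XsubC.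
by rewrite -[((2 + 2).-1)%N]/3%N !addSn add0n => -[sn];
  move: od (size_even_sqr r0); rewrite -sn /= => /negPf ->.
Qed.

End Signs.

(** A + B y is (p + q y)^2 / k. A is monic because k is the square of the leading coefficient of p,
    and at the zeros of c only p^2 / k remains. *)
Lemma pell_of_even n p q k : ~~ odd n -> k != 0 ->
  p ^+ 2 - c * q ^+ 2 = k%:P * 'X^n -> p.[0] + q.[0] * y0 = 0 -> p.[0] != 0 ->
  exists A B, pell_solution a b beta y0 n A B.
Proof.
move=> ev k0 N pq0 p0.
have kk : k^-1%:P * k%:P = 1 :> {poly F} by rewrite -polyCM mulVf.
have c0 : c.[0] = y0 ^+ 2 by rewrite y0E cubE !subr0.
have [m nE] : exists m, n = (2 * m)%N.
  by exists n./2; rewrite mul2n -[LHS]odd_double_half (negPf ev).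
have [sp sq scq] : [/\ size p = m.+1, (size q <= m.-1)%N & (size (c * q ^+ 2)%R
  <= 2 * m)%N].
  by apply: (norm_size (size_cub a b beta)); rewrite N size_Cmul // size_polyXn nE.
have p_neq0 : p != 0 by rewrite -size_poly_eq0 sp.
have lt : (size (c * q ^+ 2)%R < size (p ^+ 2)%R)%N.
  by rewrite even_size_sqr // sp doubleS /= -mul2n ltnS.
have lp : lead_coef p ^+ 2 = k.
  rewrite -lead_coef_exp -(lead_coefDl (q := - (c * q ^+ 2))) ?size_polyN // N.
  by rewrite lead_coefM lead_coefC lead_coefXn mulr1.
have AE t : (k^-1%:P * (p ^+ 2 + c * q ^+ 2)).[t]
    = k^-1 * (p.[t] ^+ 2 + c.[t] * q.[t] ^+ 2).
  by move: c => c'; rewrite !(hornerM, hornerD, hornerC, horner_exp).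
have BE t : (k^-1%:P * (2%:P * p * q)).[t] = k^-1 * (2 * p.[t] * q.[t]).
  by rewrite !(hornerM, hornerC).
exists (k^-1%:P * (p ^+ 2 + c * q ^+ 2)), (k^-1%:P * (2%:P * p * q)); split.
- by rewrite monicE lead_coefM lead_coefC lead_coefDl // lead_coef_exp lp mulVf.
- have -> : (k^-1%:P * (p ^+ 2 + c * q ^+ 2)) ^+ 2 - c * (k^-1%:P * (2%:P * p *
  q)) ^+ 2
     = (k^-1%:P * (p ^+ 2 - c * q ^+ 2)) ^+ 2 by ring.
  by rewrite N mulrA kk mul1r mulnC exprM.
- rewrite AE BE c0.
  have -> (u v w : F) : w * (u ^+ 2 + y0 ^+ 2 * v ^+ 2) + w * (2 * u * v) * y0
    = w * (u + v * y0) ^+ 2 by ring.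
  by rewrite pq0 expr0n mulr0.
rewrite !AE c0 !cubE !subrr !(mul0r, mulr0, addr0).
have H t : c.[t] = 0 -> p.[t] ^+ 2 = k * t ^+ n.
  move=> ct; have := congr1 (horner^~ t) N.
  rewrite hornerD hornerN (hornerM c) ct mul0r subr0 horner_exp.
  by rewrite hornerM hornerC hornerXn.
rewrite (H a) ?(H b) ?cubE ?subrr ?mulr0 ?mul0r //.
split; rewrite ?mulKf //; last first.
  by rewrite exprNn -signr_odd (negPf ev) mul1r.
rewrite mulf_neq0 ?invr_eq0 // -exprMn [y0 * _]mulrC.
have -> : q.[0] * y0 = - p.[0] by apply/eqP; rewrite -addr_eq0 addrC pq0.
by rewrite sqrrN -mulr2n mulrn_eq0 /= sqrf_eq0.
Qed.

(** A + B y is ((x - b) p + q y)^2 / (k (x - b)), which gives A = (u - v) / k with u + v = k x^n; v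
    vanishes at a and u at b. *)
Lemma pell_of_odd n p q k : odd n -> k != 0 ->
  ('X - b%:P) * p ^+ 2 + ('X - a%:P) * ('X - beta%:P) * q ^+ 2 = k%:P * 'X^n ->
  - b * p.[0] + q.[0] * y0 = 0 -> p.[0] != 0 ->
  exists A B, pell_solution a b beta y0 n A B.
Proof.
move=> od k0 N pq0 p0.
have kk : k^-1%:P * k%:P = 1 :> {poly F} by rewrite -polyCM mulVf.
set u := ('X - b%:P) * p ^+ 2 in N *.
set v := ('X - a%:P) * ('X - beta%:P) * q ^+ 2 in N *.
have [m nE] : exists m, n = (2 * m).+1.
  by exists n./2; rewrite mul2n -[LHS]odd_double_half od.
have Xb : 'X - b%:P != 0 :> {poly F} by rewrite polyXsubC_eq0.
have cv : c * q ^+ 2 = - (('X - b%:P) * v) by rewrite /cub /v; ring.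
(* The degrees follow from the norm k x^n (x - b) of (x - b) p + q y. *)
have [su _ sv] : [/\ size (('X - b%:P) * p) = m.+2, (size q <= m.+1.-1)%N &
    (size (c * q ^+ 2)%R <= 2 * m.+1)%N].
  apply: (norm_size (size_cub a b beta)).
  have -> : (('X - b%:P) * p) ^+ 2 - c * q ^+ 2 = ('X - b%:P) * (k%:P * 'X^n).
    by rewrite cv -N /u; ring.
  rewrite size_mul // ?mulf_neq0 ?polyC_eq0 ?expf_neq0 ?polyX_eq0 //.
  by rewrite size_XsubC size_Cmul // size_polyXn nE add2n mulnS.
have p_neq0 : p != 0 by apply: contraNneq p0 => ->; rewrite horner0.
have sp : size p = m.+1 by move: su; rewrite size_mul // size_XsubC add2n => -[].
have {su} su : size u = (2 * m).+2.
  by rewrite /u size_mul ?expf_neq0 // size_XsubC even_size_sqr // sp doubleS mul2n.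
have lt : (size v < size u)%N.
  rewrite su; have [->|v0] := eqVneq v 0; first by rewrite size_poly0.
  by move: sv; rewrite cv size_polyN size_mul // size_XsubC add2n mulnS.
have lu : lead_coef u = k.
  by rewrite -(lead_coefDl lt) N lead_coefM lead_coefC lead_coefXn mulr1.
exists (k^-1%:P * (u - v)), (k^-1%:P * (2%:P * p * q)); split.
- by rewrite monicE lead_coefM lead_coefC lead_coefDl ?size_polyN // lu mulVf.
- have -> : (k^-1%:P * (u - v)) ^+ 2 - c * (k^-1%:P * (2%:P * p * q)) ^+ 2
     = (k^-1%:P * (u + v)) ^+ 2 by rewrite /u /v /cub; ring.
  by rewrite N mulrA kk mul1r mulnC exprM.
- rewrite /u /v !(hornerM, hornerD, hornerN, hornerC, hornerX, horner_exp) !sub0r.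
  (* Multiplied by - b k, the value at Q_0 is the square of - b p(0) + q(0) y0 up to a multiple of a
     b beta - y0^2. *)
  apply: (mulfI (_ : - b * k != 0)); first by rewrite mulf_neq0 ?oppr_eq0.
  set l := LHS; have -> : l = (- b * p.[0] + q.[0] * y0) ^+ 2
      + q.[0] ^+ 2 * (a * b * beta - y0 ^+ 2) by rewrite /l; field.
  by rewrite pq0 y0E subrr expr0n !mulr0 addr0.
have uE t : u.[t] = (t - b) * p.[t] ^+ 2.
  by rewrite /u hornerM hornerXsubC horner_exp.
have vE t : v.[t] = (t - a) * (t - beta) * q.[t] ^+ 2.
  by rewrite /v 2!hornerM !hornerXsubC horner_exp.
have uvE t : u.[t] + v.[t] = k * t ^+ n by rewrite -hornerD N hornerM hornerC
  hornerXn.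
clear lu lt su sv cv; clearbody u v.
rewrite !(hornerM, hornerD, hornerN, hornerC); split.
- rewrite mulf_neq0 ?invr_eq0 // uE vE !sub0r.
  (* By the vanishing at Q_0, this is - b (u(0) - v(0)). *)
  have : 2 * p.[0] ^+ 2 * b ^+ 2 != 0.
    by rewrite !mulf_neq0 ?expf_neq0 // pnatr_eq0.
  apply: contra_neq => E.
  have qy : q.[0] * y0 = b * p.[0].
    by apply/eqP; rewrite -subr_eq0 -[X in _ == X]pq0; apply/eqP; ring.
  have -> : 2 * p.[0] ^+ 2 * b ^+ 2 = b ^+ 2 * p.[0] ^+ 2 + (q.[0] * y0) ^+ 2.
    by rewrite qy; ring.
  rewrite exprMn y0E.
  have -> (w z : F) : b ^+ 2 * w + z * (a * b * beta)
    = - b * (- b * w - - a * - beta * z) by ring.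
  by rewrite E mulr0.
- by have := uvE a; rewrite (vE a) subrr !mul0r addr0 => ->; rewrite subr0 mulKf.
have := uvE b; rewrite (uE b) subrr mul0r add0r sub0r => ->.
by rewrite mulrN mulKf // exprNn -signr_odd od mulN1r.
Qed.

End Pell.

(** * Linear equivalence *)

Section LinEquiv.
Variables (R : realType) (a b beta : R).
Hypotheses (ab : a != b) (a_beta : a != beta) (b_beta : b != beta).
Hypotheses (a0 : 0 < a) (b0 : 0 < b) (beta0 : 0 < beta).
Local Notation C := R[i].
Local Notation K := (function_field a b beta).
Local Notation cubic := (cubic a b beta).
Local Notation fpoly := (@fpoly R a b beta).
Local Notation fpair := (@fpair R a b beta).
Local Notation point := (point a b beta).
Local Notation Q0 := (Q0 a b beta).
Local Notation Qb := (Qb a b beta).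
Local Notation Qinf := (Qinf a b beta).
Implicit Types (P : point) (p q A B : {poly C}) (n : nat).
Let y0 : C := (Num.sqrt (a * b * beta))%:C.
Local Notation pell := (pell_solution a%:C b%:C beta%:C y0).

Let abbeta0 : 0 < a * b * beta. Proof. by rewrite !mulr_gt0. Qed.

Let Q0_val : val Q0 = Some (0, y0).
Proof. exact: Q0E (ltW abbeta0). Qed.

Let y0E : y0 ^+ 2 = a%:C * b%:C * beta%:C.
Proof. by rewrite /y0 -rmorphXn /= sqr_sqrtr ?ltW // !rmorphM. Qed.

Let y00 : y0 != 0.
Proof. by rewrite -sqrf_eq0 y0E -!rmorphM fmorph_eq0 gt_eqF. Qed.

Let cubic0E : cubic.[0] = y0 ^+ 2.
Proof. by rewrite cubic0 y0E -!rmorphM. Qed.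

Let C_eq (u v : R) : (u%:C == v%:C) = (u == v).
Proof. exact: (inj_eq (fmorph_inj (real_complex R))). Qed.
Let abC : a%:C != b%:C. Proof. by rewrite C_eq. Qed.
Let a_betaC : a%:C != beta%:C. Proof. by rewrite C_eq. Qed.
Let b_betaC : b%:C != beta%:C. Proof. by rewrite C_eq. Qed.
Let b0C : b%:C != 0. Proof. by rewrite fmorph_eq0 gt_eqF. Qed.

Lemma on_curveE P x1 y1 : val P = Some (x1, y1) -> y1 ^+ 2 = cubic.[x1].
Proof. by move=> PE; have := valP P; rewrite PE /= => /eqP. Qed.

Lemma coeff_diff n P Q Q' :
  coeff P (<< n%:Z *g Q >> - << n%:Z *g Q' >>)
  = n%:Z * (Q == P)%:R - n%:Z * (Q' == P)%:R.
Proof. by rewrite coeffB !coeffU. Qed.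

Lemma norm_factor p q x1 y1 : y1 ^+ 2 = cubic.[x1] ->
  (p.[x1] + q.[x1] * y1) * (p.[x1] - q.[x1] * y1) = (p ^+ 2 - cubic * q ^+ 2).[x1].
Proof.
move: cubic => c cE.
by rewrite hornerD hornerN (hornerM c) -cE !horner_exp; ring.
Qed.

Lemma has_order_elsewhere P x1 y1 p q : val P = Some (x1, y1) ->
  (p ^+ 2 - cubic * q ^+ 2).[x1] != 0 -> has_order P (fpair p q) 0.
Proof.
move=> PE N0; apply/has_order0/(unit_at_fpair PE).
by move: N0; rewrite -(norm_factor _ _ (on_curveE PE)) mulf_eq0 => /norP[].
Qed.

(** The only other point over x = 0 is (0, - y0), where p + q y takes the value p(0) - q(0) y0. *)
Lemma has_order_over0 P y1 p q : val P = Some (0, y1) -> P != Q0 ->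
  p.[0] - q.[0] * y0 != 0 -> has_order P (fpair p q) 0.
Proof.
move=> PE PQ pq0; have := on_curveE PE; rewrite cubic0E => /eqP.
rewrite eqf_sqr => /orP[] /eqP y1E.
  by case/eqP: PQ; apply: val_inj; rewrite Q0_val PE y1E.
apply/has_order0/(unit_at_fpair PE).
by rewrite y1E mulrN.
Qed.

(** The norm does not see the sign of q. It is fixed so that p + q y vanishes at Q_0, and then not
    at (0, - y0), since p(0) is nonzero. *)
Lemma choose_sign p q : p.[0] != 0 -> p.[0] ^+ 2 = q.[0] ^+ 2 * y0 ^+ 2 ->
  exists2 e : bool, p.[0] + ((-1) ^+ e * q).[0] * y0 = 0 &
    p.[0] - ((-1) ^+ e * q).[0] * y0 != 0.
Proof.
move=> p0 E; have : exists e : bool, p.[0] + ((-1) ^+ e * q).[0] * y0 = 0.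
  move/eqP: E; rewrite -exprMn eqf_sqr => /orP[] /eqP pE.
    by exists true; rewrite mulN1r hornerN mulNr pE subrr.
  by exists false; rewrite mul1r pE addNr.
move=> [e eE]; exists e => //.
have -> : ((-1) ^+ e * q).[0] * y0 = - p.[0] by apply/eqP;
  rewrite -addr_eq0 addrC eE.
by rewrite opprK -mulr2n mulrn_eq0.
Qed.

(** p + q y has norm 2 x^n, so its affine zeros lie over x = 0; the choice of sign puts them all at
    Q_0, and the degrees of p and q give the pole of order n at infinity. *)
Lemma lin_equiv_of_pell_even n A B : (0 < n)%N -> ~~ odd n -> pell n A B ->
  lin_equiv << n%:Z *g Q0 >> << n%:Z *g Qinf >>.
Proof.
move=> n0 ev AB; have [_ _ _ [A0 _ _]] := AB.
have [p [q [N p0E]]] := pell_even abC a_betaC b_betaC n0 AB ev.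
rewrite -[cub _ _ _]/cubic in N.
have p0 : p.[0] != 0 by rewrite -sqrf_eq0 p0E.
have pq0 : p.[0] ^+ 2 = q.[0] ^+ 2 * y0 ^+ 2.
  apply/eqP; rewrite -subr_eq0; have := congr1 (horner^~ 0) N.
  move: cubic cubic0E => c <-;
    rewrite hornerD hornerN (hornerM c) !horner_exp mulrC => ->.
  by rewrite hornerM hornerXn expr0n gtn_eqF // mulr0.
have [e pq0' pq1] := choose_sign p0 pq0.
have {}N : p ^+ 2 - cubic * ((-1) ^+ e * q) ^+ 2 = 'X^n * 2%:P.
  by rewrite exprMn sqrr_sign mul1r N mulrC.
move: {q pq0}((-1) ^+ e * q) pq0' pq1 N => q pq0 pq1 N.
have [m nE] : exists m, n = (2 * m)%N.
  by exists n./2; rewrite mul2n -[LHS]odd_double_half (negPf ev).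
have [sp sq _] : [/\ size p = m.+1, (size q <= m.-1)%N & (size (cubic * q ^+
  2)%R <= 2 * m)%N].
  apply: norm_size; first exact: size_cubic.
  by rewrite N mulrC size_Cmul ?pnatr_eq0 // size_polyXn nE.
exists (fpair p q).
  by apply: (@fpair_neq0 R a b beta _ _ 0 (- y0)); rewrite mulrN.
move=> P; rewrite coeff_diff; case PE: (val P) => [[x1 y1]|].
  have -> : (Qinf == P) = false.
    by apply/eqP => QP; move: PE; rewrite -QP.
  rewrite mulr0 subr0; have [<-|PQ] := eqVneq Q0 P.
    rewrite mulr1; apply: (has_order_Q0 Q0_val y00 N) => //.
    by rewrite hornerC pnatr_eq0.
  rewrite mulr0; have [x10|x10] := eqVneq x1 0.
    by rewrite x10 in PE; apply: (has_order_over0 PE) => //; rewrite eq_sym.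
  apply: (has_order_elsewhere PE); rewrite N hornerM hornerXn hornerC.
  by rewrite mulf_neq0 ?expf_neq0 ?pnatr_eq0.
have -> : (Qinf == P) = true by apply/eqP/val_inj; rewrite PE.
have -> : (Q0 == P) = false by apply/eqP => QP; move: PE; rewrite -QP Q0_val.
by rewrite mulr0 sub0r mulr1 nE; apply: has_order_inf.
Qed.

Let Xb : {poly C} := 'X - b%:C%:P.

Lemma has_order_Xb P x1 y1 : val P = Some (x1, y1) -> P != Qb ->
  has_order P (fpoly Xb) 0.
Proof.
move=> PE PQ; rewrite -fpair0E; apply/has_order0/(unit_at_fpair PE).
rewrite horner0 mul0r addr0 hornerXsubC subr_eq0.
apply: contraNneq PQ => x1E; apply/eqP/val_inj; rewrite PE x1E.
have := on_curveE PE; rewrite cubicE x1E subrr mulr0 mul0r => /eqP.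
by rewrite sqrf_eq0 => /eqP ->.
Qed.

Lemma has_order_quo P (f g : K) k l m : has_order P f k -> has_order P g l ->
  has_order P (f / g ^+ m) (k - l * m%:Z).
Proof. by move=> fk gl; apply: has_orderM fk (has_orderV (has_orderX _ gl)). Qed.

Lemma Q0_neq_Qb : Q0 != Qb.
Proof.
apply/eqP => /(congr1 (fun P : point => if val P is Some (t, _) then t else 0)).
by rewrite Q0_val /= => /esym/eqP; rewrite (negPf b0C).
Qed.

(** The function is ((x - b) p + q y) / (x - b)^m with 2m = n + 1: the numerator has divisor n Q_0 +
    Q_b - (n + 1) Q_oo, and x - b has divisor 2 Q_b - 2 Q_oo. *)
Lemma lin_equiv_of_pell_odd n A B : odd n -> pell n A B ->
  lin_equiv << n%:Z *g Q0 >> << n%:Z *g Qb >>.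
Proof.
move=> od AB; have n0 : (0 < n)%N by case: n od {AB}.
have [_ _ _ [A0 _ _]] := AB.
have [p [q [N p0E]]] := pell_odd a_betaC b_betaC n0 AB od.
have p0 : p.[0] != 0.
  by rewrite -sqrf_eq0; apply: contraNneq A0 => p0; rewrite -p0E p0 mulr0.
(* At x = b only the term with q survives in the identity, and 2 b^n is nonzero; the numerator then
   has order exactly 1 at Q_b. *)
have qb : q.[b%:C] != 0.
  have := congr1 (horner^~ b%:C) N.
  rewrite hornerD hornerM hornerXsubC subrr mul0r add0r 2!hornerM horner_exp.
  move=> E; have : (2%:P * 'X^n : {poly C}).[b%:C] != 0.
    by rewrite hornerM hornerC hornerXn mulf_neq0 ?pnatr_eq0 ?expf_neq0.
  by rewrite -E; apply: contraNneq => ->; rewrite expr0n mulr0.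
have {}N : (Xb * p) ^+ 2 - cubic * q ^+ 2 = 'X^n * (2%:P * Xb).
  by rewrite mulrA [_ * 2%:P]mulrC -N /Xb /cubic; ring.
have Xbp0 : (Xb * p).[0] != 0.
  by rewrite hornerM mulf_neq0 // hornerXsubC sub0r oppr_eq0.
have pq0 : (Xb * p).[0] ^+ 2 = q.[0] ^+ 2 * y0 ^+ 2.
  apply/eqP; rewrite -subr_eq0; have := congr1 (horner^~ 0) N.
  move: cubic cubic0E => c <-; move: (Xb * p) => p'.
  rewrite hornerD hornerN (hornerM c) !horner_exp mulrC => ->.
  by rewrite hornerM hornerXn expr0n gtn_eqF // mul0r.
have [e pq0' pq1] := choose_sign Xbp0 pq0.
have {}N : (Xb * p) ^+ 2 - cubic * ((-1) ^+ e * q) ^+ 2 = 'X^n * (2%:P * Xb).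
  by rewrite [(_ ^+ e * q) ^+ 2]exprMn sqrr_sign mul1r N.
have qb' : ((-1) ^+ e * q).[b%:C] != 0.
  by case: (e); rewrite ?mulN1r ?hornerN ?oppr_eq0 ?mul1r.
move: {q pq0 qb}((-1) ^+ e * q) pq0' pq1 N qb' => q pq0 pq1 N qb.
have [m nE] : exists m, n.+1 = (2 * m)%N.
  by exists n.+1./2; rewrite mul2n -[LHS]odd_double_half /= od.
have sN : size ((Xb * p) ^+ 2 - cubic * q ^+ 2) = (2 * m).+1.
  rewrite N mulrC size_mul ?mulf_neq0 ?polyC_eq0 ?pnatr_eq0 ?expf_neq0
    ?polyX_eq0 ?polyXsubC_eq0 //.
  by rewrite size_Cmul ?pnatr_eq0 // size_XsubC size_polyXn add2n nE.
have [sp sq _] := norm_size (size_cubic a b beta) sN.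
exists (fpair (Xb * p) q / fpoly Xb ^+ m).
  rewrite mulf_neq0 ?invr_eq0 ?expf_neq0 //.
    by apply: (@fpair_neq0 R a b beta _ _ 0 (- y0)); rewrite mulrN.
  by rewrite fpoly_eq0 polyXsubC_eq0.
move=> P; rewrite coeff_diff.
have [<-|PQ0] := eqVneq Q0 P.
  have -> : n%:Z * true%:R - n%:Z * (Qb == Q0)%:R = n%:Z - 0 * m%:Z.
    by rewrite eq_sym (negPf Q0_neq_Qb) mulr1 mulr0 mul0r.
  apply: has_order_quo; last exact: has_order_Xb Q0_val Q0_neq_Qb.
  apply: (has_order_Q0 Q0_val y00 N) => //.
  by rewrite hornerM hornerXsubC hornerC sub0r mulf_neq0 ?oppr_eq0 ?pnatr_eq0.
have [<-|PQb] := eqVneq Qb P.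
  have -> : n%:Z * false%:R - n%:Z * true%:R = 1 - 2 * m%:Z.
    by rewrite mulr0 mulr1 sub0r -[2 * _]/((2 * m)%N : int) -nE intS; ring.
  apply: has_order_quo; last exact: has_order_Qb_sub.
  exact: has_order_Qb.
case PE: (val P) => [[x1 y1]|].
  have -> : n%:Z * false%:R - n%:Z * false%:R = 0 - 0 * m%:Z by rewrite !mulr0
    mul0r.
  apply: has_order_quo; last by apply: has_order_Xb PE _; rewrite eq_sym.
  have [x10|x10] := eqVneq x1 0.
    by rewrite x10 in PE; apply: (has_order_over0 PE) => //; rewrite eq_sym.
  apply: (has_order_elsewhere PE); rewrite N 2!hornerM hornerXn hornerC.
  rewrite !mulf_neq0 ?expf_neq0 ?pnatr_eq0 // hornerXsubC subr_eq0.
  apply: contraNneq PQb => x1E; apply/eqP/val_inj; rewrite PE x1E.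
  have := on_curveE PE; rewrite cubicE x1E subrr mulr0 mul0r => /eqP.
  by rewrite sqrf_eq0 => /eqP ->.
have -> : n%:Z * false%:R - n%:Z * false%:R = - (2 * m)%:Z - (- (2 * 1)%:Z) * m%:Z.
  by rewrite !mulr0 !PoszM; ring.
apply: has_order_quo; first exact: has_order_inf.
rewrite -fpair0E; apply: has_order_inf => //; first by rewrite size_XsubC.
by rewrite size_poly0.
Qed.

(** With no affine pole, f is of the form p + q y. Its only affine zero is Q_0, so its norm is k x^n
    with k constant, and (p + q y)^2 / k solves Pell's equation. *)
Lemma pell_of_lin_equiv_even n : (0 < n)%N -> ~~ odd n ->
  lin_equiv << n%:Z *g Q0 >> << n%:Z *g Qinf >> -> exists A B, pell n A B.
Proof.
move=> n0 ev [f f0 fD].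
have aff P x1 y1 : val P = Some (x1, y1) ->
    has_order P f (if P == Q0 then n%:Z else 0).
  move=> PE; have := fD P; rewrite coeff_diff eq_sym.
  have -> : (Qinf == P) = false by apply/eqP => QP; move: PE; rewrite -QP.
  by case: (P == Q0); rewrite ?mulr1 !mulr0 subr0.
have [p [q fE]] : exists p q, f = fpair p q.
  apply: regular_polynomial => P x1 y1 /aff; case: ifP => _ H;
    [by exists n | by exists 0%N].
rewrite {f f0 fD}fE in aff.
have pq0 : p.[0] + q.[0] * y0 = 0.
  by apply: (has_order_Q0_eval Q0_val y00 n0); have := aff _ _ _ Q0_val;
    rewrite eqxx.
have nonzero x1 y1 : y1 ^+ 2 = cubic.[x1] -> (x1, y1) <> (0, y0) ->
    p.[x1] + q.[x1] * y1 != 0.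
  move=> /eqP yE Pneq; have PE : val (@curve_point R a b beta x1 y1 yE) = Some
    (x1, y1) by [].
  apply: (has_order0_eval PE); have := aff _ _ _ PE; case: ifP => // /eqP PQ.
  by case: Pneq; move: PE; rewrite PQ Q0_val => -[-> ->].
have pq1 : p.[0] - q.[0] * y0 != 0.
  rewrite -mulrN; apply: nonzero; first by rewrite sqrrN cubic0E.
  move=> /(congr1 snd) /= /eqP.
  by rewrite eq_sym -addr_eq0 -mulr2n mulrn_eq0 (negPf y00).
have [|N NE N0] := has_order_Q0_norm Q0_val y00 pq1 (n := n).
  by have := aff _ _ _ Q0_val; rewrite eqxx.
have p0 : p.[0] != 0.
  apply: contraNneq pq1 => p0; move: pq0; rewrite p0 add0r => ->.
  by rewrite subr0.
(* Above a root z of N, which is nonzero, one of the points (z, y1) and (z, - y1) would be a zero of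
   f. *)
have sN : size N = 1%N.
  apply/eqP; apply: contraT => /closed_rootP[z Nz].
  have z0 : z != 0 by apply: contraNneq N0 => zE; rewrite -/(root N 0) -zE.
  have [y1 yE] : exists y1, y1 ^+ 2 = cubic.[z] by exists (sqrtC cubic.[z]);
    exact: sqrtCK.
  have : (p ^+ 2 - cubic * q ^+ 2).[z] = 0 by rewrite NE hornerM (rootP Nz) mulr0.
  rewrite -(norm_factor _ _ yE) => /eqP/idPn[].
  by apply: mulf_neq0; rewrite -?mulrN; apply: nonzero;
    rewrite ?sqrrN // => /(congr1 fst)/eqP; rewrite (negPf z0).
have [k k0 NkE] := size_poly1P _ (introT eqP sN).
apply: (pell_of_even y0E ev k0 (p := p) (q := q)) => //.
by rewrite -[cub _ _ _]/cubic NE NkE mulrC.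
Qed.

(** Multiplied by (x - b)^m with 2m = n + 1, f loses its pole at Q_b and gets a simple zero there.
    It becomes (x - b) p' + q y, of norm k x^n (x - b). *)
Lemma pell_of_lin_equiv_odd n : odd n ->
  lin_equiv << n%:Z *g Q0 >> << n%:Z *g Qb >> -> exists A B, pell n A B.
Proof.
move=> od [f f0 fD]; have n0 : (0 < n)%N by case: n od {fD}.
have [m nE] : exists m, n.+1 = (2 * m)%N.
  by exists n.+1./2; rewrite mul2n -[LHS]odd_double_half /= od.
have aff P x1 y1 : val P = Some (x1, y1) ->
    has_order P (f * fpoly Xb ^+ m) (if P == Q0 then n%:Z else if P == Qb then
      1 else 0).
  move=> PE; have := fD P; rewrite coeff_diff ![_ == P]eq_sym.
  have [-> H|PQ0] := eqVneq P Q0.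
    rewrite -[n%:Z]addr0 -(mul0r m%:Z); apply: has_orderM.
      by move: H; rewrite (negPf Q0_neq_Qb) mulr1 mulr0 subr0.
    by apply: has_orderX; apply: has_order_Xb Q0_val Q0_neq_Qb.
  have [-> H|PQb H] := eqVneq P Qb.
    have -> : 1 = - n%:Z + 2 * m%:Z by rewrite -[2 * _]/((2 * m)%N : int) -nE
      intS; ring.
    apply: has_orderM; first by move: H; rewrite mulr0 mulr1 sub0r.
    by apply: has_orderX; apply: has_order_Qb_sub.
  rewrite -[0]addr0 -{2}(mul0r m%:Z); apply: has_orderM.
    by move: H; rewrite !mulr0 subr0.
  by apply: has_orderX; apply: has_order_Xb PE PQb.
move: {f f0 fD}(f * _) aff => f aff.
have [p [q fE]] : exists p q, f = fpair p q.
  apply: regular_polynomial => P x1 y1 /aff; case: ifP => _; first by exists n.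
  by case: ifP => _ H; [exists 1%N | exists 0%N].
rewrite {f}fE in aff.
have pq0 : p.[0] + q.[0] * y0 = 0.
  by apply: (has_order_Q0_eval Q0_val y00 n0); have := aff _ _ _ Q0_val;
    rewrite eqxx.
have [pb qb] : p.[b%:C] = 0 /\ q.[b%:C] != 0.
  have QbQ0 : (Qb == Q0) = false by rewrite eq_sym; apply: negPf Q0_neq_Qb.
  have := aff Qb b%:C 0 erefl; rewrite QbQ0 (eqxx Qb) => H.
  exact: (has_order_Qb_eval H).
have nonzero x1 y1 : y1 ^+ 2 = cubic.[x1] -> (x1, y1) <> (0, y0) ->
    (x1, y1) <> (b%:C, 0) -> p.[x1] + q.[x1] * y1 != 0.
  move=> /eqP yE Pneq0 Pneqb.
  have PE : val (@curve_point R a b beta x1 y1 yE) = Some (x1, y1) by [].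
  apply: (has_order0_eval PE); have := aff _ _ _ PE; case: ifP => [/eqP PQ|_].
    by case: Pneq0; move: PE; rewrite PQ Q0_val => -[-> ->].
  case: ifP => // /eqP PQ.
  by case: Pneqb; move: PE; rewrite PQ => -[-> ->].
have pq1 : p.[0] - q.[0] * y0 != 0.
  rewrite -mulrN; apply: nonzero; first by rewrite sqrrN cubic0E.
    move=> /(congr1 snd) /= /eqP.
    by rewrite eq_sym -addr_eq0 -mulr2n mulrn_eq0 (negPf y00).
  by move=> /(congr1 fst) /= /esym/eqP; rewrite (negPf b0C).
have [|N NE N0] := has_order_Q0_norm Q0_val y00 pq1 (n := n).
  by have := aff _ _ _ Q0_val; rewrite eqxx.
have p0 : p.[0] != 0.
  apply: contraNneq pq1 => p0; move: pq0; rewrite p0 add0r => ->.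
  by rewrite subr0.
have /factor_theorem[p' pE] : root p b%:C by apply/rootP.
have /factor_theorem[N' N'E] : root N b%:C.
  have := congr1 (horner^~ b%:C) NE.
  rewrite -(@norm_factor p q b%:C 0) ?cubicE ?subrr ?mulr0 ?mul0r ?expr0n //.
  rewrite pb addr0 mul0r hornerM hornerXn => /esym/eqP.
  by rewrite mulf_eq0 expf_eq0 (negPf b0C) andbF.
have Xb0 : Xb != 0 by rewrite polyXsubC_eq0.
have NE' : Xb * p' ^+ 2 + ('X - a%:C%:P) * ('X - beta%:C%:P) * q ^+ 2 = 'X^n * N'.
  apply: (mulfI Xb0); have -> : Xb * ('X^n * N') = 'X^n * N by rewrite N'E /Xb;
    ring.
  by rewrite -NE pE /Xb /cubic; ring.
have sN : size N' = 1%N.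
  apply/eqP; apply: contraT => /closed_rootP[z Nz].
  have z0 : z != 0.
    by apply: contraNneq N0 => zE; rewrite -/(root N 0) N'E rootM -zE Nz.
  (* At z = b the left side of [NE'] is (b - a)(b - beta) q(b)^2, which is nonzero. *)
  have [zb|zb] := eqVneq z b%:C.
    have := congr1 (horner^~ z) NE'; rewrite [RHS]hornerM (rootP Nz) mulr0.
    rewrite hornerD (hornerM Xb) (hornerM _ (q ^+ 2)) (hornerM ('X - _))
      !hornerXsubC (horner_exp q) zb subrr mul0r add0r => /eqP.
    move=> /idPn[]; apply: mulf_neq0; last exact: expf_neq0.
    by apply: mulf_neq0; rewrite subr_eq0 // eq_sym.
  have [y1 yE] : exists y1, y1 ^+ 2 = cubic.[z] by exists (sqrtC cubic.[z]);
    exact: sqrtCK.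
  have : (p ^+ 2 - cubic * q ^+ 2).[z] = 0.
    by rewrite NE N'E 2!hornerM (rootP Nz) mul0r mulr0.
  rewrite -(norm_factor _ _ yE) => /eqP/idPn[].
  by apply: mulf_neq0; rewrite -?mulrN; apply: nonzero;
    rewrite ?sqrrN // => /(congr1 fst)/eqP; rewrite ?(negPf z0) ?(negPf zb).
have [k k0 NkE] := size_poly1P _ (introT eqP sN).
apply: (pell_of_odd b0C y0E od k0 (p := p') (q := q)).
- by rewrite NE' NkE mulrC.
- by move: pq0; rewrite pE hornerM hornerXsubC sub0r mulrC.
by apply: contraNneq p0 => p'0; rewrite pE hornerM p'0 mul0r.
Qed.

End LinEquiv.

(** * The Lax pair *)

Lemma monic_addl (F : idomainType) m (p q : {poly F}) :
  p \is monic -> size p = m.+1 -> (size q <= m)%N ->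
  p + q \is monic /\ size (p + q) = m.+1.
Proof.
move=> mp sp sq; have lt : (size q < size p)%N by rewrite sp.
by rewrite monicE lead_coefDl // size_polyDl // sp (monicP mp).
Qed.

Lemma size_const_mul (F : idomainType) (k : F) (p : {poly F}) :
  (size (k%:P * p)%R <= size p)%N.
Proof. by rewrite mul_polyC size_scale_leq. Qed.

Lemma size_add_leq (F : idomainType) m (p q : {poly F}) :
  (size p <= m)%N -> (size q <= m)%N -> (size (p + q)%R <= m)%N.
Proof. by move=> sp sq; rewrite (leq_trans (size_polyD _ _)) // geq_max sp. Qed.

Lemma size_mul_leq (F : idomainType) m n (p q : {poly F}) :
  (size p <= m)%N -> (size q <= n.+1)%N -> (size (p * q)%R <= m + n)%N.
Proof.
move=> sp sq; apply: leq_trans (size_polyMleq _ _) _.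
by have := leq_add sp sq; rewrite addnS; case: (size p + size q)%N.
Qed.

Lemma cub_squarefree (F : fieldType) (a b beta r : F) (G : {poly F}) :
  a != b -> a != beta -> b != beta -> cub a b beta <> ('X - r%:P) ^+ 2 * G.
Proof.
move=> ab a_beta b_beta E.
have simple H : cub a b beta = ('X - r%:P) * H -> H.[r] = 0.
  have Xr : 'X - r%:P != 0 :> {poly F} by rewrite polyXsubC_eq0.
  by rewrite E expr2 -mulrA => /(mulfI Xr) <-;
    rewrite hornerM hornerXsubC subrr mul0r.
have : (a - r) * (b - r) * (beta - r) == 0.
  have := congr1 (horner^~ r) E; rewrite [RHS]hornerM horner_exp hornerXsubC subrr.
  by rewrite expr0n mul0r /cub !hornerE => ->.
rewrite !mulf_eq0 !subr_eq0 -orbA => /or3P[] /eqP rE.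
- have /simple : cub a b beta = ('X - r%:P) * - ((b%:P - 'X) * (beta%:P - 'X)).
    by rewrite /cub rE; ring.
  rewrite hornerN hornerM !hornerE => /eqP; rewrite -rE oppr_eq0 mulf_eq0 !subr_eq0.
  by rewrite ![_ == a]eq_sym (negPf ab) (negPf a_beta).
- have /simple : cub a b beta = ('X - r%:P) * - ((a%:P - 'X) * (beta%:P - 'X)).
    by rewrite /cub rE; ring.
  rewrite hornerN hornerM !hornerE => /eqP; rewrite -rE oppr_eq0 mulf_eq0 !subr_eq0.
  by rewrite (negPf ab) eq_sym (negPf b_beta).
have /simple : cub a b beta = ('X - r%:P) * - ((a%:P - 'X) * (b%:P - 'X)).
  by rewrite /cub rE; ring.
rewrite hornerN hornerM !hornerE => /eqP; rewrite -rE oppr_eq0 mulf_eq0 !subr_eq0.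
by rewrite (negPf a_beta) (negPf b_beta).
Qed.

(** * Algebraic identities of the Lax matrix *)

Section LaxPair.
Variables (A : comNzRingType) (a b X : A).
Implicit Types (p v t mu : A) (chi psi : A * A).

Definition laxU v1 v2 := v1 ^+ 2 * (b - X) + v2 ^+ 2 * (a - X).
Definition laxV p1 p2 v1 v2 := p1 * v1 * (b - X) + p2 * v2 * (a - X).
Definition laxW p1 p2 :=
  p1 ^+ 2 * (b - X) + p2 ^+ 2 * (a - X) - (a - X) * (b - X).

Definition lax p1 p2 v1 v2 chi : A * A :=
  (laxV p1 p2 v1 v2 * chi.1 - laxU v1 v2 * chi.2,
   laxW p1 p2 * chi.1 - laxV p1 p2 v1 v2 * chi.2).

(** The two factors of a transfer matrix: a free flight of duration t, of determinant 1, and a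
    reflection with coefficient mu, of determinant X^2. The flip contributes no factor, as U, V and
    W are unchanged by it. *)
Definition shear t chi : A * A := (chi.1, chi.2 + t * chi.1).
Definition bounce mu chi : A * A := (X * chi.1 - 2 * mu * chi.2, X * chi.2).

Definition combine c chi d psi : A * A :=
  (c * chi.1 + d * psi.1, c * chi.2 + d * psi.2).

Lemma shear_lax t p1 p2 v1 v2 chi :
  shear t (lax p1 p2 v1 v2 chi)
  = lax (p1 + t * v1) (p2 + t * v2) v1 v2 (shear t chi).
Proof. by rewrite /shear /lax /laxU /laxV /laxW /=; congr (_, _); ring. Qed.

(** Both components of the difference are combinations of the equation of the ellipse at (a n1, b
    n2) and of the relation that defines mu. *)
Lemma bounce_lax (n1 n2 v1 v2 mu : A) chi :
  a * n1 ^+ 2 + b * n2 ^+ 2 = 1 ->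
  mu * (n1 ^+ 2 + n2 ^+ 2) = v1 * n1 + v2 * n2 ->
  bounce mu (lax (a * n1) (b * n2) v1 v2 chi)
  = lax (a * n1) (- (b * n2)) (v1 - 2 * mu * n1) (- (v2 - 2 * mu * n2))
      (bounce mu chi).
Proof.
move=> on refl; rewrite /bounce /lax /laxU /laxV /laxW /=.
congr (_, _); apply/eqP; rewrite -subr_eq0; apply/eqP.
  transitivity (- 2 * mu * (a - X) * (b - X) *
    ((a * n1 ^+ 2 + b * n2 ^+ 2 - 1) * chi.1
     + 2 * (mu * (n1 ^+ 2 + n2 ^+ 2) - (v1 * n1 + v2 * n2)) * chi.2));
       first by ring.
  by rewrite on refl !subrr; ring.
transitivity (2 * mu * (a - X) * (b - X) * (a * n1 ^+ 2 + b * n2 ^+ 2 - 1) * chi.2).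
  by ring.
by rewrite on subrr; ring.
Qed.

(** On the boundary W is divisible by X, so the Lax matrix is triangular at X = 0. *)
Lemma laxW_on (n1 n2 : A) : a * n1 ^+ 2 + b * n2 ^+ 2 = 1 ->
  laxW (a * n1) (b * n2) = X * (a * n1 ^+ 2 * (b - X) + b * n2 ^+ 2 * (a - X)).
Proof.
move=> on; apply/eqP; rewrite -subr_eq0 /laxW; apply/eqP.
transitivity ((a - X) * (b - X) * (a * n1 ^+ 2 + b * n2 ^+ 2 - 1)); first by ring.
by rewrite on subrr mulr0.
Qed.

(** This is minus the determinant of the Lax matrix. For a unit velocity on a line tangent to the
    conic of parameter beta, the last factor is beta - X. *)
Lemma lax_det p1 p2 v1 v2 :
  laxV p1 p2 v1 v2 ^+ 2 - laxU v1 v2 * laxW p1 p2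
  = (a - X) * (b - X) * (a * v2 ^+ 2 + b * v1 ^+ 2 - (p1 * v2 - p2 * v1) ^+ 2
      - (v1 ^+ 2 + v2 ^+ 2) * X).
Proof. by rewrite /laxU /laxV /laxW; ring. Qed.

Lemma lax_lax p1 p2 v1 v2 chi :
  lax p1 p2 v1 v2 (lax p1 p2 v1 v2 chi)
  = combine (laxV p1 p2 v1 v2 ^+ 2 - laxU v1 v2 * laxW p1 p2) chi 0 chi.
Proof. by rewrite /lax /combine /=; congr (_, _); ring. Qed.

Lemma shear_combine t c chi d psi :
  shear t (combine c chi d psi) = combine c (shear t chi) d (shear t psi).
Proof. by rewrite /shear /combine /=; congr (_, _); ring. Qed.

Lemma bounce_combine mu c chi d psi :
  bounce mu (combine c chi d psi) = combine c (bounce mu chi) d (bounce mu psi).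
Proof. by rewrite /bounce /combine /=; congr (_, _); ring. Qed.

Lemma lax_combine p1 p2 v1 v2 c chi d psi :
  lax p1 p2 v1 v2 (combine c chi d psi)
  = combine c (lax p1 p2 v1 v2 chi) d (lax p1 p2 v1 v2 psi).
Proof. by rewrite /lax /combine /=; congr (_, _); ring. Qed.

End LaxPair.

(* A billiard orbit in coordinates: (p1, p2) and (v1, v2) are the position and
   the velocity, t the time of flight, and mu the coefficient of the normal
   (n1, n2) = (q1/a, q2/b) in the reflection at the point (q1, q2) of impact,
   which is followed by the flip. J is the Joachimsthal invariant. *)
Record billiard_orbit (F : fieldType) (a b beta J : F) (p1 p2 v1 v2 t mu : nat
  -> F) : Prop :=
  Orbit {
    orbit_on : forall k, (p1 k + t k * v1 k) ^+ 2 / a + (p2 k + t k * v2 k) ^+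
      2 / b = 1;
    orbit_J : forall k,
      v1 k * ((p1 k + t k * v1 k) / a) + v2 k * ((p2 k + t k * v2 k) / b) = J;
    orbit_mu : forall k, mu k *
      (((p1 k + t k * v1 k) / a) ^+ 2 + ((p2 k + t k * v2 k) / b) ^+ 2) = J;
    orbit_unit : forall k, v1 k ^+ 2 + v2 k ^+ 2 = 1;
    orbit_caustic : forall k,
      a * v2 k ^+ 2 + b * v1 k ^+ 2 - (p1 k * v2 k - p2 k * v1 k) ^+ 2 = beta;
    orbit_p1 : forall k, p1 k.+1 = p1 k + t k * v1 k;
    orbit_p2 : forall k, p2 k.+1 = - (p2 k + t k * v2 k);
    orbit_v1 : forall k, v1 k.+1 = v1 k - 2 * mu k * ((p1 k + t k * v1 k) / a);
    orbit_v2 : forall k, v2 k.+1 = - (v2 k - 2 * mu k * ((p2 k + t k * v2 k) /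
      b)) }.

(** * The transfer matrix of an orbit *)

Section Orbit.
Variables (F : numFieldType) (a b beta J : F) (p1 p2 v1 v2 t mu : nat -> F).
Hypotheses (a0 : a != 0) (b0 : b != 0) (J0 : J != 0).
Hypotheses (ab : a != b) (a_beta : a != beta) (b_beta : b != beta).
Hypothesis beta0 : beta != 0.
Hypothesis O : billiard_orbit a b beta J p1 p2 v1 v2 t mu.
Hypotheses (t0 : forall k, t k != 0).
Local Notation c := (cub a b beta).
Local Notation y0 := (a * b * J).
Implicit Types (n k : nat) (chi psi : {poly F} * {poly F}) (A B : {poly F}).

Let n1 k := (p1 k + t k * v1 k) / a.
Let n2 k := (p2 k + t k * v2 k) / b.
Let q1E k : p1 k + t k * v1 k = a * n1 k. Proof. by rewrite /n1 [RHS]mulrC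
  divfK. Qed.
Let q2E k : p2 k + t k * v2 k = b * n2 k. Proof. by rewrite /n2 [RHS]mulrC
  divfK. Qed.
Let onE k : a * n1 k ^+ 2 + b * n2 k ^+ 2 = 1.
Proof. by rewrite -(orbit_on O k) q1E q2E; field; rewrite ?a0 ?b0. Qed.
Let reflE k : mu k * (n1 k ^+ 2 + n2 k ^+ 2) = v1 k * n1 k + v2 k * n2 k.
Proof. by rewrite (orbit_J O) (orbit_mu O). Qed.
Let mu0 k : mu k != 0.
Proof.
by move: J0; rewrite -(orbit_mu O k); apply: contraNneq => ->; rewrite mul0r.
Qed.

Definition laxop k : {poly F} * {poly F} -> {poly F} * {poly F} :=
  lax a%:P b%:P 'X (p1 k)%:P (p2 k)%:P (v1 k)%:P (v2 k)%:P.

Definition step k chi := bounce 'X (mu k)%:P (shear (t k)%:P chi).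

Fixpoint flow n chi := if n is k.+1 then step k (flow k chi) else chi.

Lemma step_laxop k chi : step k (laxop k chi) = laxop k.+1 (step k chi).
Proof.
rewrite /step /laxop shear_lax -!polyCM -!polyCD q1E q2E.
rewrite (orbit_p1 O) (orbit_p2 O) (orbit_v1 O) (orbit_v2 O) q1E q2E.
rewrite [a * n1 k / a]mulrC mulKf // [b * n2 k / b]mulrC mulKf //.
move: (n1 k) (n2 k) (onE k) (reflE k) => m1 m2 on refl.
rewrite !polyCM bounce_lax.
- by rewrite !(polyCN, polyCB, polyCM) (rmorph_nat _ 2).
- by rewrite -!polyC_exp -!polyCM -polyCD on.
- by rewrite -!polyC_exp -!polyCM -!polyCD -polyCM refl.
Qed.

Lemma flow_laxop n chi : flow n (laxop 0 chi) = laxop n (flow n chi).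
Proof. by elim: n => //= n ->; rewrite step_laxop. Qed.

Lemma step_combine k A chi B psi :
  step k (combine A chi B psi) = combine A (step k chi) B (step k psi).
Proof. by rewrite /step shear_combine bounce_combine. Qed.

Lemma flow_combine n A chi B psi :
  flow n (combine A chi B psi) = combine A (flow n chi) B (flow n psi).
Proof. by elim: n => //= n ->; rewrite step_combine. Qed.

Lemma laxop_combine k A chi B psi :
  laxop k (combine A chi B psi) = combine A (laxop k chi) B (laxop k psi).
Proof. exact: lax_combine. Qed.

Lemma laxop_laxop k chi : laxop k (laxop k chi) = combine c chi 0 chi.
Proof.
rewrite /laxop lax_lax lax_det; congr (combine _ _ _ _); rewrite /cub.
rewrite -!polyC_exp -!polyCM -!polyCB -!polyC_exp -!polyCD -polyCB.
by rewrite (orbit_caustic O) (orbit_unit O) mul1r.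
Qed.

Let U k := laxU a%:P b%:P 'X (v1 k)%:P (v2 k)%:P.
Let V k := laxV a%:P b%:P 'X (p1 k)%:P (p2 k)%:P (v1 k)%:P (v2 k)%:P.
Let W k := laxW a%:P b%:P 'X (p1 k)%:P (p2 k)%:P.

Let UE k x : (U k).[x] = v1 k ^+ 2 * (b - x) + v2 k ^+ 2 * (a - x).
Proof. by rewrite /U /laxU !hornerE. Qed.
Let VE k x : (V k).[x] = p1 k * v1 k * (b - x) + p2 k * v2 k * (a - x).
Proof. by rewrite /V /laxV !hornerE. Qed.
Let WE k x : (W k).[x]
  = p1 k ^+ 2 * (b - x) + p2 k ^+ 2 * (a - x) - (a - x) * (b - x).
Proof. by rewrite /W /laxW !hornerE. Qed.

Lemma lax_cub k : V k ^+ 2 - U k * W k = c.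
Proof.
have /(congr1 fst) := laxop_laxop k (1, 0).
by rewrite /laxop /lax /combine /= !mulr1 !mulr0 !subr0 addr0 -/(V k) -/(U k)
  -/(W k) => <-; ring.
Qed.

Let at_ x chi := (chi.1.[x], chi.2.[x]).

(** The shear replaces p1 by the abscissa q1 of the impact, and at x = a the bounce gives (a v1 - 2
    mu q1, a q1), which is a times the next (v1, p1). *)
Lemma flow_at_a n chi (l : F) : at_ a chi = (l * v1 0, l * p1 0) ->
  at_ a (flow n chi) = (a ^+ n * l * v1 n, a ^+ n * l * p1 n).
Proof.
move=> H; elim: n => [|n]; first by rewrite !mul1r.
rewrite /at_ => -[/= E1 E2]; rewrite !hornerE /= E1 E2 (orbit_v1 O) (orbit_p1 O).
rewrite exprS; move: (a ^+ n) => s.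
by congr (_, _); field.
Qed.

(** As at a, except that the flip changes the sign of both entries, whence the factor - b. *)
Lemma flow_at_b n chi (l : F) : at_ b chi = (l * v2 0, l * p2 0) ->
  at_ b (flow n chi) = ((- b) ^+ n * l * v2 n, (- b) ^+ n * l * p2 n).
Proof.
move=> H; elim: n => [|n]; first by rewrite !mul1r.
rewrite /at_ => -[/= E1 E2]; rewrite !hornerE /= E1 E2 (orbit_v2 O) (orbit_p2 O).
rewrite exprS; move: ((- b) ^+ n) => s.
by congr (_, _); field.
Qed.

Definition M11 n := (flow n (1, 0)).1.
Definition M21 n := (flow n (1, 0)).2.
Definition M12 n := (flow n (0, 1)).1.
Definition M22 n := (flow n (0, 1)).2.

Lemma flow_entries n chi : flow n chi
  = (M11 n * chi.1 + M12 n * chi.2, M21 n * chi.1 + M22 n * chi.2).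
Proof.
have {1}-> : chi = combine chi.1 (1, 0) chi.2 (0, 1).
  by case: chi => u v; rewrite /combine /= !mulr0 !mulr1 addr0 add0r.
by rewrite flow_combine /combine /M11 /M12 /M21 /M22; congr (_, _); ring.
Qed.

Lemma det_flow n : M11 n * M22 n - M12 n * M21 n = 'X^(2 * n).
Proof.
elim: n => [|n IH].
  by rewrite /M11 /M12 /M21 /M22 /= expr0; ring.
rewrite mulnS exprD -IH /M11 /M12 /M21 /M22 /=; ring.
Qed.

(** The matrix of [step k] is x times the unipotent matrix of the shear plus a constant matrix with
    zero second row, so the coefficient of x^n in the product is lower triangular and unipotent. *)
Lemma flow_sizes n :
  [/\ M11 n \is monic /\ size (M11 n) = n.+1, (size (M12 n) <= n)%N,
      (size (M21 n) <= n.+1)%N & M22 n \is monic /\ size (M22 n) = n.+1].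
Proof.
elim: n => [|n [[m11 s11] s12 s21 [m22 s22]]].
  by rewrite /M11 /M12 /M21 /M22 /= size_poly0 monic1 size_poly1.
have X_mul (p : {poly F}) m : (size p <= m)%N -> (size ('X * p)%R <= m.+1)%N.
  by move=> sp; rewrite -[m.+1]addn1 mulrC size_mul_leq // size_polyX.
have kick (p q : {poly F}) : (size p <= n.+1)%N -> (size q <= n.+1)%N ->
    (size (- (2 * (mu n)%:P * (p + (t n)%:P * q)))%R <= n.+1)%N.
  move=> sp sq; rewrite size_polyN -(rmorph_nat polyC 2) -polyCM.
  apply: leq_trans (size_const_mul _ _) _; apply: size_add_leq => //.
  exact: leq_trans (size_const_mul _ _) _.
split.
- apply: monic_addl; first by rewrite monicMl ?monicX.
    by rewrite mulrC size_mulX ?s11 // monic_neq0.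
  by apply: kick; rewrite -/(M21 n) -/(M11 n) ?s11.
- apply: size_add_leq; first exact: X_mul.
  by apply: kick; rewrite -/(M22 n) -/(M12 n) ?s22 // ltnW.
- apply: X_mul; apply: size_add_leq => //.
  by rewrite (leq_trans (size_const_mul _ _)) // -/(M11 n) s11.
have [] := @monic_addl _ n (M22 n) ((t n)%:P * M12 n) m22 s22.
  exact: leq_trans (size_const_mul _ _) _.
rewrite -[M22 n.+1]/('X * (M22 n + (t n)%:P * M12 n)).
move=> m s; split; first by rewrite monicMl ?monicX.
by rewrite mulrC size_mulX ?s // monic_neq0.
Qed.

Lemma laxU_linear : U 0 = (v1 0 ^+ 2 * b + v2 0 ^+ 2 * a)%:P - 'X.
Proof.
rewrite -['X]mul1r -[1%R]/(1%:P) -(orbit_unit O 0) /U /laxU.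
by rewrite !(polyCD, polyCM, polyC_exp); ring.
Qed.

Let size_U0 : size (U 0) = 2.
Proof. by rewrite laxU_linear -opprB size_polyN size_XsubC. Qed.

Lemma step_at0 k chi :
  at_ 0 (step k chi) = (- 2 * mu k * (chi.2.[0] + t k * chi.1.[0]), 0).
Proof. by rewrite /at_ /= !hornerE /=; congr (_, _); ring. Qed.

Lemma flow_at0_e1 n : at_ 0 (flow n.+1 (1, 0)) = (\prod_(k < n.+1) (- 2 * mu k
  * t k), 0).
Proof.
elim: n => [|n IH].
  by rewrite big_ord1 step_at0 /= horner0 hornerC mulr1 add0r.
rewrite -[flow n.+2 _]/(step n.+1 (flow n.+1 _)) step_at0 big_ord_recr.
by move: IH; rewrite /at_ => -[-> ->];
  rewrite add0r [X in (X, _)]mulrA [X in (X, _)]mulrC.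
Qed.

Lemma flow_at0_ker n : at_ 0 (flow n.+1 (1, - (t 0)%:P)) = (0, 0).
Proof.
elim: n => [|n IH].
  by rewrite step_at0 /= hornerN !hornerC mulr1 addNr mulr0.
rewrite -[flow n.+2 _]/(step n.+1 (flow n.+1 _)) step_at0.
by move: IH; rewrite /at_ => -[-> ->]; rewrite mulr0 addr0 mulr0.
Qed.

Lemma pell_of_closed_orbit n tau : (0 < n)%N -> v1 n = v1 0 -> v2 n = v2 0 ->
  p1 0 = p1 n + tau * v1 n -> p2 0 = p2 n + tau * v2 n ->
  exists A B, pell_solution a b beta y0 n A B.
Proof.
move=> n0 v1E v2E p1E p2E.
(* The n steps are followed by a free flight of duration tau, which brings the orbit back to its
   initial data. *)
pose N chi := shear tau%:P (flow n chi).
have N_laxop chi : N (laxop 0 chi) = laxop 0 (N chi).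
  by rewrite /N flow_laxop /laxop shear_lax -!polyCM -!polyCD -p1E -p2E v1E v2E.
pose N11 := M11 n; pose N12 := M12 n.
pose N21 := M21 n + tau%:P * M11 n; pose N22 := M22 n + tau%:P * M12 n.
have NE chi : N chi = (N11 * chi.1 + N12 * chi.2, N21 * chi.1 + N22 * chi.2).
  by rewrite /N flow_entries /shear /N11 /N12 /N21 /N22 /=; congr (_, _); ring.
have detN : N11 * N22 - N12 * N21 = 'X^(2 * n).
  by rewrite -det_flow /N11 /N12 /N21 /N22; ring.
have C1 : W 0 * N12 = - U 0 * N21 /\ W 0 * (N11 - N22) = 2 * V 0 * N21.
  have := N_laxop (1, 0);
    rewrite !NE /laxop /lax /= -/(V 0) -/(U 0) -/(W 0) => -[E1 E2].
  split; apply/eqP; rewrite -subr_eq0; apply/eqP.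
    by move/eqP: E1; rewrite -subr_eq0 => /eqP <-; ring.
  by move/esym/eqP: E2; rewrite -subr_eq0 => /eqP <-; ring.
have C2 : U 0 * (N11 - N22) = - 2 * V 0 * N12.
  have := N_laxop (0, 1);
    rewrite !NE /laxop /lax /= -/(V 0) -/(U 0) -/(W 0) => -[E1 E2].
  apply/eqP; rewrite -subr_eq0; apply/eqP.
  by move/esym/eqP: E1; rewrite -subr_eq0 => /eqP <-; ring.
have [C1a C1b] := C1.
have U0 : U 0 != 0 by rewrite -size_poly_gt0 size_U0.
set r := v1 0 ^+ 2 * b + v2 0 ^+ 2 * a.
have Ur : (U 0).[r] = 0 by rewrite laxU_linear !hornerE subrr.
have two : 2 != 0 :> F by rewrite pnatr_eq0.
(* If N12 did not vanish at the root r of U, the commutation relations would make W and V vanish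
   there, and c = V^2 - U W would have a double root. *)
have N12r : N12.[r] = 0.
  apply/eqP; apply: contraT => N12r.
  have Wr : root (W 0) r.
    have := congr1 (horner^~ r) C1a;
      rewrite !hornerM hornerN Ur oppr0 mul0r => /eqP.
    by rewrite mulf_eq0 (negPf N12r) orbF.
  have Vr : root (V 0) r.
    have := congr1 (horner^~ r) C2; rewrite -(rmorph_nat polyC 2) -polyCN.
    rewrite !hornerM hornerC Ur mul0r => /esym/eqP.
    by rewrite !mulf_eq0 (negPf N12r) orbF oppr_eq0 (negPf two).
  have [W' WE'] := factor_theorem _ _ Wr; have [V' VE'] := factor_theorem _ _ Vr.
  case: (@cub_squarefree _ a b beta r (V' ^+ 2 + W') ab a_beta b_beta).
  by rewrite -(lax_cub 0) WE' VE' laxU_linear -/r; ring.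
have [B' N12E] := factor_theorem _ _ (introT eqP N12r).
have {}N12E : N12 = - U 0 * B' by rewrite N12E laxU_linear -/r; ring.
have N21E : N21 = W 0 * B'.
  apply: (mulfI U0); apply: (can_inj opprK); rewrite -!mulNr -C1a N12E; ring.
have N1122 : N11 - N22 = 2 * V 0 * B'.
  by apply: (mulfI U0); rewrite C2 N12E; ring.
(* A' is half the trace of N, and N = A' + B' L. *)
pose A' := N11 - V 0 * B'.
have N11E : N11 = A' + V 0 * B' by rewrite /A'; ring.
have N22E : N22 = A' - V 0 * B'.
  have -> : N22 = N11 - (N11 - N22) by ring.
  by rewrite N1122 /A'; ring.
have N11x x : N11.[x] = A'.[x] + (V 0).[x] * B'.[x].
  by rewrite {1}N11E hornerD (hornerM (V 0)).
have N22x x : N22.[x] = A'.[x] - (V 0).[x] * B'.[x].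
  by rewrite {1}N22E hornerD hornerN (hornerM (V 0)).
have N12x x : N12.[x] = - (U 0).[x] * B'.[x].
  by rewrite N12E (hornerM (- U 0)) hornerN.
have N21x x : N21.[x] = (W 0).[x] * B'.[x] by rewrite N21E (hornerM (W 0)).
exists A', B'.
have norm : A' ^+ 2 - c * B' ^+ 2 = 'X^(2 * n).
  by rewrite -detN N11E N22E N12E N21E -(lax_cub 0); ring.
have N21h x : N21.[x] = (M21 n).[x] + tau * (M11 n).[x] by rewrite hornerD hornerCM.
have N22h x : N22.[x] = (M22 n).[x] + tau * (M12 n).[x] by rewrite hornerD hornerCM.
have N_a : (N11.[a] * v1 0 + N12.[a] * p1 0 = a ^+ n * v1 0) /\
    (N21.[a] * v1 0 + N22.[a] * p1 0 = a ^+ n * p1 0).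
  have H : at_ a ((v1 0)%:P, (p1 0)%:P) = (1 * v1 0, 1 * p1 0).
    by rewrite /at_ !hornerC !mul1r.
  have := flow_at_a n H; rewrite flow_entries /at_ /= mulr1.
  rewrite !(hornerD (M11 n * _)) !(hornerD (M21 n * _)) !hornerM !hornerC =>
    -[E1 E2].
  rewrite N21h N22h; split; first by rewrite E1 v1E.
  by rewrite !mulrDl addrACA E2 -!mulrA -mulrDr E1 p1E; ring.
have N_b : (N11.[b] * v2 0 + N12.[b] * p2 0 = (- b) ^+ n * v2 0) /\
    (N21.[b] * v2 0 + N22.[b] * p2 0 = (- b) ^+ n * p2 0).
  have H : at_ b ((v2 0)%:P, (p2 0)%:P) = (1 * v2 0, 1 * p2 0).
    by rewrite /at_ !hornerC !mul1r.
  have := flow_at_b n H; rewrite flow_entries /at_ /= mulr1.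
  rewrite !(hornerD (M11 n * _)) !(hornerD (M21 n * _)) !hornerM !hornerC =>
    -[E1 E2].
  rewrite N21h N22h; split; first by rewrite E1 v2E.
  by rewrite !mulrDl addrACA E2 -!mulrA -mulrDr E1 p2E; ring.
split => //.
- have [[m11 s11] s12 _ [m22 s22]] := flow_sizes n.
  have [m22' s22'] : N22 \is monic /\ size N22 = n.+1.
    by apply: monic_addl => //; apply: leq_trans (size_const_mul _ _) _.
  have -> : A' = (2^-1)%:P * (N11 + N22).
    have -> : N11 + N22 = 2%:P * A' by rewrite N11E N22E (rmorph_nat polyC 2); ring.
    by rewrite mulrA -polyCM mulVf // mul1r.
  have l2 : (N11 + N22)`_n = 2.
    rewrite coefD -{1}[n]/(n.+1.-1) -{1}s11 -[n in N22`_n]/(n.+1.-1) -s22'.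
    by rewrite -!/(lead_coef _) (monicP m11) (monicP m22').
  have sz : size (N11 + N22) = n.+1.
    apply/eqP; rewrite eqn_leq; apply/andP; split.
      by apply: size_add_leq; rewrite ?s11 ?s22'.
    by apply: contraT; rewrite -leqNgt => /leq_sizeP/(_ n (leqnn n))/eqP;
      rewrite l2 (negPf two).
  by rewrite monicE lead_coefM lead_coefC /lead_coef sz /= l2 mulVf.
(* At x = 0 the vector (1, - [t 0]) is killed by N, and V(0) + [t 0] U(0) = a b J. *)
- have := flow_at0_ker n.-1; rewrite (prednK n0) flow_entries /at_ /= => -[E _].
  have : N11.[0] - t 0 * N12.[0] = 0.
    by rewrite -[RHS]E hornerD mulr1 (hornerM (M12 n)) hornerN hornerC; ring.
  rewrite N11x N12x => E0; rewrite -[RHS]E0 VE UE !subr0.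
  rewrite -(orbit_J O 0); by field; rewrite ?a0 ?b0.
(* Were A'(0) = 0, the norm would give B'(0) = 0 and so N11(0) = 0, whereas N11(0) is a product of
   nonzero factors - 2 mu t. *)
have A0 : A'.[0] != 0.
  apply/eqP => A0; have : N11.[0] != 0.
    have := flow_at0_e1 n.-1; rewrite (prednK n0) /at_ => -[E _].
    rewrite [N11.[0]]E; apply/prodf_neq0 => k _.
    by rewrite !mulf_neq0 // oppr_eq0.
  rewrite N11x A0 add0r.
  have := congr1 (horner^~ 0) norm.
  rewrite hornerD hornerN (hornerM c) !horner_exp A0 hornerX !expr0n muln_eq0
    /= (gtn_eqF n0) sub0r.
  rewrite horner_cub !subr0 => /eqP; rewrite oppr_eq0 mulf_eq0 sqrf_eq0.
  rewrite (negPf (mulf_neq0 (mulf_neq0 a0 b0) beta0)) => /eqP ->.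
  by rewrite mulr0 eqxx.
split => //.
(* Otherwise the orbit would start along the axis x = 0, and beta would be a. *)
- have vp : (v1 0 != 0) || (p1 0 != 0).
    apply: contraT; rewrite negb_or !negbK => /andP[/eqP v10 /eqP p10].
    case/eqP: a_beta; rewrite -(orbit_caustic O 0) -[a in LHS]mulr1
      -(orbit_unit O 0) v10 p10.
    by ring.
  have [E1 E2] := N_a; move: E1 E2; rewrite N11x N12x N21x N22x.
  rewrite VE UE WE subrr !(mulr0, mul0r, addr0, subr0) => E1 E2.
  case/orP: vp => [v10|p10].
    by apply: (mulIf v10); rewrite -E1; ring.
  by apply: (mulIf p10); rewrite -E2; ring.
have vp : (v2 0 != 0) || (p2 0 != 0).
  apply: contraT; rewrite negb_or !negbK => /andP[/eqP v10 /eqP p10].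
  case/eqP: b_beta; rewrite -(orbit_caustic O 0) -[b in LHS]mulr1 -(orbit_unit
    O 0) v10 p10.
  by ring.
have [E1 E2] := N_b; move: E1 E2; rewrite N11x N12x N21x N22x.
rewrite VE UE WE subrr !(mulr0, mul0r, addr0, add0r, subr0) => E1 E2.
case/orP: vp => [v10|p10].
  by apply: (mulIf v10); rewrite -E1; ring.
by apply: (mulIf p10); rewrite -E2; ring.
Qed.

(** * From Pell's equation back to a closed orbit *)

Local Notation scale u chi := (combine u chi 0 chi).

(* At x = 0 the kernel of step k is the eigenline of the Lax matrix for the
   eigenvalue y0; the hypothesis puts chi on it modulo x^2. *)
Lemma step_divisible k A B chi G : A.[0] + B.[0] * y0 = 0 -> A.[0] != 0 ->
  combine A chi B (laxop k chi) = scale ('X ^+ 2) G ->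
  exists psi, step k chi = scale ('X ^+ 2) psi.
Proof.
move=> AB0 A0 E; have := congr1 (fun xi => (shear (t k)%:P xi).2) E.
rewrite !shear_combine /laxop shear_lax -!polyCM -!polyCD q1E q2E.
have := orbit_J O k; have := orbit_mu O k; have := onE k; rewrite -/(n1 k) -/(n2 k).
move: (n1 k) (n2 k) => m1 m2 on muJ vJ; rewrite !polyCM /step.
move: (shear _ chi) (shear _ G) => [x1 x2] [G1 G2].
rewrite /lax [in LHS]/combine /= laxW_on; last first.
  by rewrite -!polyC_exp -!polyCM -polyCD on.
set V' := laxV _ _ _ _ _ _ _; set Phi := _ + _ * (_ - 'X);
  rewrite mul0r addr0 => E2.
have V'0 : V'.[0] = y0 by rewrite /V' /laxV !hornerE -vJ /=; ring.
have Phi0 : Phi.[0] = a * b * (m1 ^+ 2 + m2 ^+ 2) by rewrite /Phi !hornerE /=; ring.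
have B0 : B.[0] != 0.
  by apply: contraNneq A0 => B0; move: AB0; rewrite B0 mul0r addr0 => ->.
have By0 : A.[0] = - (B.[0] * y0) by apply/eqP; rewrite -addr_eq0 AB0.
clearbody V' Phi.
(* At x = 0 the relation [E2] reads 2 A(0) x2(0) = 0, because V' takes the value y0 = - A(0) / B(0)
   there. *)
have /factor_theorem[psi x2E] : root x2 0.
  have := congr1 (horner^~ 0) E2; rewrite [RHS]hornerM hornerXn expr0n mul0r.
  rewrite hornerD !(hornerM A, hornerM B) hornerD hornerN !hornerM hornerX V'0
    => E20.
  have : 2 * A.[0] * x2.[0] == 0.
    apply/eqP; transitivity (A.[0] * x2.[0] + - (B.[0] * y0) * x2.[0]).
      by rewrite -By0; ring.
    by rewrite -[RHS]E20; ring.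
  by rewrite !mulf_eq0 pnatr_eq0 (negPf A0).
have X0 : 'X != 0 :> {poly F} by rewrite polyX_eq0.
rewrite subr0 in x2E.
have E3 : A * psi + B * (Phi * x1 - V' * psi) = 'X * G2.
  by apply: (mulfI X0); rewrite mulrA -expr2 -E2 x2E; ring.
(* Divided by x, the same relation gives x1 - 2 mu psi = 0 at x = 0, since y0 = mu Phi(0). *)
have /factor_theorem[om omE] : root (x1 - 2 * (mu k)%:P * psi) 0.
  have := congr1 (horner^~ 0) E3; rewrite [RHS]hornerM hornerX mul0r.
  rewrite hornerD !(hornerM A, hornerM B) hornerD hornerN !hornerM V'0 Phi0 => E30.
  rewrite /root hornerD hornerN hornerM hornerM hornerC -(rmorph_nat polyC 2)
    hornerC.
  have nn0 : m1 ^+ 2 + m2 ^+ 2 != 0.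
    by move: J0; rewrite -muJ; apply: contraNneq => ->; rewrite mulr0.
  have : B.[0] * (a * b * (m1 ^+ 2 + m2 ^+ 2)) * (x1.[0] - 2 * mu k * psi.[0]) == 0.
    apply/eqP; transitivity (- (B.[0] * y0) * psi.[0] + B.[0] *
        (a * b * (m1 ^+ 2 + m2 ^+ 2) * x1.[0] - y0 * psi.[0])).
      by rewrite -muJ; ring.
    by rewrite -By0 -[RHS]E30; ring.
  by rewrite 4!mulf_eq0 (negPf B0) (negPf a0) (negPf b0) (negPf nn0).
rewrite subr0 in omE.
exists (om, psi); rewrite /bounce /combine /= x2E; congr (_, _); last by ring.
have -> : 'X * x1 - 2 * (mu k)%:P * (psi * 'X) = 'X * (x1 - 2 * (mu k)%:P *
  psi) by ring.
by rewrite omE; ring.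
Qed.

Lemma scale_inj (u : {poly F}) chi psi : u != 0 -> scale u chi = scale u psi ->
  chi = psi.
Proof.
move=> u0; case: chi psi => [x1 x2] [z1 z2]; rewrite /combine /= !mul0r !addr0.
by move=> [/(mulfI u0) -> /(mulfI u0) ->].
Qed.

Lemma scale_scale (u w : {poly F}) chi : scale u (scale w chi) = scale (u * w) chi.
Proof. by rewrite /combine /= !mul0r !addr0 !mulrA. Qed.

(** The identity (A + B L)(A - B L) = A^2 - c B^2 = x^(2n) starts the induction. The second relation
    is carried along because, as long as k < n, it supplies the divisibility by x^2 that
    [step_divisible] asks for. *)
Lemma pell_divides n A B e : pell_solution a b beta y0 n A B ->
  forall k, (k <= n)%N -> exists psi,
    flow k (combine A e (- B) (laxop 0 e)) = scale ('X^(2 * k)) psi /\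
    combine A psi B (laxop k psi) = scale ('X^(2 * (n - k))) (flow k e).
Proof.
move=> [_ N AB0 [A0 _ _]]; elim=> [|k IH] kn.
  exists (combine A e (- B) (laxop 0 e)); split.
    by rewrite /combine /= expr0 !mul1r !mul0r !addr0.
  rewrite laxop_combine laxop_laxop subn0 -N /combine /= !mul0r !addr0.
  by congr (_, _); ring.
have [psi [SE psiE]] := IH (ltnW kn).
have nk : (2 * (n - k) = 2 + 2 * (n - k.+1))%N by rewrite -mulnS -subSn ?subSS.
rewrite nk exprD -scale_scale in psiE.
have [xi xiE] := step_divisible AB0 A0 psiE; exists xi; split.
  rewrite -[flow k.+1 _]/(step k (flow k _)) SE step_combine xiE mulnSr exprD.
  exact: scale_scale.
have X2 : 'X^2 != 0 :> {poly F} by rewrite expf_neq0 ?polyX_eq0.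
apply: (scale_inj X2); rewrite -[flow k.+1 e]/(step k (flow k e)).
have -> : scale ('X^2) (combine A xi B (laxop k.+1 xi))
  = combine A (scale ('X^2) xi) B (laxop k.+1 (scale ('X^2) xi)).
  by rewrite laxop_combine /combine /= !mul0r !addr0; congr (_, _); ring.
rewrite -xiE -step_laxop -step_combine psiE step_combine.
rewrite /combine /= !mul0r !addr0; congr (_, _); ring.
Qed.

Let size_linear (u w : F) : (size (u%:P + w%:P * 'X)%R <= 2)%N.
Proof.
apply: size_add_leq; first by rewrite (leq_trans (size_polyC_leq1 _)).
by rewrite (leq_trans (size_const_mul _ _)) // size_polyX.
Qed.

Let size_U : (size (U 0) <= 2)%N.
Proof. by rewrite size_U0. Qed.

Let size_V : (size (V 0) <= 2)%N.
Proof.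
have -> : V 0 = (p1 0 * v1 0 * b + p2 0 * v2 0 * a)%:P
    + (- (p1 0 * v1 0 + p2 0 * v2 0))%:P * 'X.
  by rewrite /V /laxV !(polyCN, polyCD, polyCM); ring.
exact: size_linear.
Qed.

Let size_W : (size (W 0) <= 3)%N.
Proof.
have -> : W 0 = - 'X^2 + ((p1 0 ^+ 2 * b + p2 0 ^+ 2 * a - a * b)%:P
    + (a + b - (p1 0 ^+ 2 + p2 0 ^+ 2))%:P * 'X).
  by rewrite /W /laxW !(polyCN, polyCD, polyCM, polyC_exp); ring.
apply: size_add_leq; first by rewrite size_polyN size_polyXn.
exact: leq_trans (size_linear _ _) _.
Qed.

Let size_quo m (p q : {poly F}) : 'X^m * p = q -> (size p <= size q - m)%N.
Proof.
have [->|p0 <-] := eqVneq p 0; first by rewrite size_poly0.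
by rewrite mulrC size_mulXn // addKn.
Qed.

Let monic_quo m (p q : {poly F}) : 'X^m * p = q -> q \is monic -> size q = m.+1
  -> p = 1.
Proof.
move=> E mq sq; have mp : p \is monic by rewrite -(monicMl _ (monicXn F m)) E.
have := size_quo E; rewrite sq subSnn => sp.
have /size1_polyC pE := sp; rewrite pE; congr (_%:P).
by move/monicP: mp; rewrite pE lead_coefC coefC.
Qed.

(** The transfer matrix times A - B L is x^(2n) T. Degrees make T the matrix of a free flight of
    duration tau, and the equality is then read on (v1, p1) at x = a and on (v2, p2) at x = b. *)
Lemma closed_orbit_of_pell n A B : (0 < n)%N -> pell_solution a b beta y0 n A B ->
  exists tau, [/\ v1 n = v1 0, v2 n = v2 0, p1 n = p1 0 + tau * v1 0
    & p2 n = p2 0 + tau * v2 0].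
Proof.
move=> n0 AB; have [sA sB] := pell_size AB.
have [mA _ _ [A0 Aa Ab]] := AB.
have [[m11 s11] s12 s21 [m22 s22]] := flow_sizes n.
have [[T11 T21] [T1E _]] := pell_divides (1, 0) AB (leqnn n).
have [[T12 T22] [T2E _]] := pell_divides (0, 1) AB (leqnn n).
have sBV : (size (B * V 0)%R <= n)%N.
  by have := size_mul_leq sB size_V; rewrite addn1 prednK.
have sBU : (size (B * U 0)%R <= n)%N.
  by have := size_mul_leq sB size_U; rewrite addn1 prednK.
have sBW : (size (B * W 0)%R <= n.+1)%N.
  by have := size_mul_leq sB size_W; rewrite addn2 prednK.
(* [D1] and [D2] are the diagonal entries of A - B L. *)
pose D1 := A - B * V 0; pose D2 := A + B * V 0.
have [mD1 sD1] : D1 \is monic /\ size D1 = n.+1 by apply: monic_addl => //;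
  rewrite size_polyN.
have [mD2 sD2] : D2 \is monic /\ size D2 = n.+1 by apply: monic_addl.
have nn : (n.+1 + n = (2 * n).+1)%N by rewrite mul2n -addnn.
move: (T1E) (T2E); rewrite !flow_entries /combine /laxop /lax /= -/(U 0) -/(V
  0) -/(W 0).
move=> -[E11 E21] [E12 E22].
have {}E11 : 'X^(2 * n) * T11 = M11 n * D1 + - (M12 n * (B * W 0)).
  by apply: etrans (etrans (esym E11) _); rewrite ?mul0r ?addr0 // /D1; ring.
have {}E21 : 'X^(2 * n) * T21 = M21 n * D1 - M22 n * (B * W 0).
  by apply: etrans (etrans (esym E21) _); rewrite ?mul0r ?addr0 // /D1; ring.
have {}E12 : 'X^(2 * n) * T12 = M11 n * (B * U 0) + M12 n * D2.
  by apply: etrans (etrans (esym E12) _); rewrite ?mul0r ?addr0 // /D2; ring.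
have {}E22 : 'X^(2 * n) * T22 = M22 n * D2 + M21 n * (B * U 0).
  by apply: etrans (etrans (esym E22) _); rewrite ?mul0r ?addr0 // /D2; ring.
(* The product of diagonal entries is monic of degree 2n, and the other term has smaller degree. *)
have T11_1 : T11 = 1.
  have [|||m s] := @monic_addl _ (2 * n) (M11 n * D1) (- (M12 n * (B * W 0))).
  - by rewrite monicMl.
  - by rewrite size_Mmonic ?monic_neq0 // s11 sD1 addnS nn.
  - by rewrite size_polyN mul2n -addnn size_mul_leq.
  exact: monic_quo E11 m s.
have T22_1 : T22 = 1.
  have [|||m s] := @monic_addl _ (2 * n) (M22 n * D2) (M21 n * (B * U 0)).
  - by rewrite monicMl.
  - by rewrite size_Mmonic ?monic_neq0 // s22 sD2 addnS nn.
  - by rewrite mulrC mul2n -addnn size_mul_leq.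
  exact: monic_quo E22 m s.
have T12_0 : T12 = 0.
  apply/eqP; rewrite -size_poly_eq0 -leqn0; apply: leq_trans (size_quo E12) _.
  rewrite leq_subLR addn0; apply: size_add_leq; rewrite mul2n -addnn.
    by rewrite mulrC size_mul_leq ?s11.
  by rewrite size_mul_leq ?sD2.
have [tau T21E] : exists tau, T21 = tau%:P.
  exists T21`_0; apply: size1_polyC; apply: leq_trans (size_quo E21) _.
  rewrite leq_subLR addn1; apply: size_add_leq; rewrite ?size_polyN -nn.
    by rewrite size_mul_leq ?sD1.
  by rewrite mulrC size_mul_leq ?s22.
have flow_T (u w : F) : flow n (combine A (u%:P, w%:P) (- B) (laxop 0 (u%:P, w%:P)))
    = scale ('X^(2 * n)) (u%:P, (tau * u + w)%:P).
  have -> : combine A (u%:P, w%:P) (- B) (laxop 0 (u%:P, w%:P)) = combine u%:P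
      (combine A (1, 0) (- B) (laxop 0 (1, 0))) w%:P (combine A (0, 1) (- B)
        (laxop 0 (0, 1))).
    by rewrite /combine /laxop /lax /=; congr (_, _); ring.
  rewrite flow_combine T1E T2E T11_1 T12_0 T21E T22_1 /combine /= polyCD polyCM.
  by congr (_, _); ring.
exists tau.
(* L kills (v1, p1) at x = a, so A - B L acts on it as A(a) = a^n. *)
have at_a : at_ a (combine A ((v1 0)%:P, (p1 0)%:P) (- B) (laxop 0 ((v1 0)%:P,
  (p1 0)%:P)))
    = (a ^+ n * v1 0, a ^+ n * p1 0).
  rewrite /at_ /combine /laxop /lax /= -/(U 0) -/(V 0) -/(W 0) !hornerD
    !(hornerM (- B)).
  rewrite !hornerD !hornerN !(hornerM A, hornerM (U 0), hornerM (V 0), hornerM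
    (W 0)).
  by rewrite !hornerC UE VE WE Aa; congr (_, _); ring.
have at_b : at_ b (combine A ((v2 0)%:P, (p2 0)%:P) (- B) (laxop 0 ((v2 0)%:P,
  (p2 0)%:P)))
    = ((- b) ^+ n * v2 0, (- b) ^+ n * p2 0).
  rewrite /at_ /combine /laxop /lax /= -/(U 0) -/(V 0) -/(W 0) !hornerD
    !(hornerM (- B)).
  rewrite !hornerD !hornerN !(hornerM A, hornerM (U 0), hornerM (V 0), hornerM
    (W 0)).
  by rewrite !hornerC UE VE WE Ab; congr (_, _); ring.
have := flow_at_a n at_a; have := flow_at_b n at_b.
rewrite !flow_T /at_ /combine /= !mul0r !addr0 !hornerM !hornerXn !hornerC.
(* The factor x^(2n) cancels: at b one (- b)^n comes from A and the other from the flow. *)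
have bn : b ^+ (2 * n) = (- b) ^+ n * (- b) ^+ n.
  by rewrite -exprMn mulrNN -expr2 exprM.
have an : a ^+ (2 * n) = a ^+ n * a ^+ n by rewrite -exprMn -expr2 exprM.
have bn0 : (- b) ^+ n * (- b) ^+ n != 0 by rewrite -bn expf_neq0.
have an0 : a ^+ n * a ^+ n != 0 by rewrite -an expf_neq0.
rewrite an bn => -[/(mulfI bn0) E2v /(mulfI bn0) E2p] [/(mulfI an0) E1v /(mulfI
  an0) E1p].
by split; rewrite -?E1v -?E2v -?E1p -?E2p // addrC.
Qed.

End Orbit.

(** * Trajectories *)

Lemma orbit_map (F F' : fieldType) (f : {rmorphism F -> F'}) a b beta J p1 p2
  v1 v2 t mu :
  billiard_orbit a b beta J p1 p2 v1 v2 t mu ->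
  billiard_orbit (f a) (f b) (f beta) (f J) (f \o p1) (f \o p2) (f \o v1) (f \o v2)
    (f \o t) (f \o mu).
Proof.
case=> on vJ muJ unit caustic p1E p2E v1E v2E; split=> k /=.
- by rewrite -(rmorph1 f) -(on k) !(rmorphD, rmorphM, rmorphXn) /= !fmorphV.
- by rewrite -(vJ k) !(rmorphD, rmorphM, rmorphXn) /= !fmorphV.
- by rewrite -(muJ k) !(rmorphD, rmorphM, rmorphXn) /= !fmorphV.
- by rewrite -(rmorph1 f) -(unit k) !(rmorphD, rmorphM, rmorphXn).
- by rewrite -(caustic k) !(rmorphB, rmorphD, rmorphM, rmorphXn).
- by rewrite p1E rmorphD rmorphM.
- by rewrite p2E rmorphN rmorphD rmorphM.
- by rewrite v1E rmorphB !rmorphM rmorph_nat /= rmorphD rmorphM fmorphV.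
- by rewrite v2E rmorphN rmorphB !rmorphM rmorph_nat /= rmorphD rmorphM fmorphV.
Qed.

(** A closed real orbit gives a real solution, on which signs can be studied; linear equivalence
    uses it over the complex numbers. *)
Lemma pell_map (F F' : fieldType) (f : {rmorphism F -> F'}) a b beta y0 n A B :
  pell_solution a b beta y0 n A B ->
  pell_solution (f a) (f b) (f beta) (f y0) n (map_poly f A) (map_poly f B).
Proof.
move=> [mA N AB0 [A0 Aa Ab]].
have cubE : cub (f a) (f b) (f beta) = map_poly f (cub a b beta).
  by rewrite /cub !(rmorphM, rmorphB) /= !map_polyC map_polyX.
split.
- by rewrite map_monic.
- rewrite cubE -(map_polyXn f) -N rmorphB; congr (_ - _); first by rewrite rmorphXn.
  by rewrite [RHS]rmorphM; congr (_ * _); rewrite rmorphXn.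
- by rewrite -(rmorph0 f) !horner_map -rmorphM -rmorphD AB0.
split.
- by rewrite -[X in _.[X]](rmorph0 f) horner_map fmorph_eq0.
- by rewrite horner_map Aa rmorphXn.
by rewrite -rmorphN horner_map Ab rmorphXn.
Qed.

(** A vanishes at some x in [b, a], and there c(x) B(x)^2 = - x^(2n) < 0, whereas c(x) would be
    nonnegative for beta <= b. *)
Lemma pell_odd_hyperbola (R : rcfType) (a b beta y0 : R) n A B :
  0 < b -> b < a -> odd n -> pell_solution a b beta y0 n A B -> b < beta.
Proof.
move=> b0 ba od [_ N _ [_ Aa Ab]]; rewrite ltNge; apply/negP => beta_b.
have a0 := lt_trans b0 ba.
have [|x] := @poly_ivt _ A b a (ltW ba).
  by rewrite Aa Ab exprNn -signr_odd od mulN1r oppr_le0 !exprn_ge0 ?ltW //.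
move=> /andP[bx xa] /rootP Ax.
have := congr1 (horner^~ x) N; rewrite hornerD hornerN (hornerM (cub _ _ _)).
rewrite horner_cub !horner_exp Ax hornerX expr0n sub0r => E.
have : 0 < x ^+ (2 * n) by rewrite exprn_gt0 // (lt_le_trans b0).
rewrite -E oppr_gt0 ltNge; apply/negP/negPn.
rewrite mulr_ge0 ?sqr_ge0 // mulr_le0 ?subr_le0 ?(le_trans beta_b) //.
by rewrite mulr_ge0_le0 ?subr_ge0 ?subr_le0.
Qed.

Section Trajectory.
Variables (R : realType) (a b beta : R) (T : trajectory a b).
Hypotheses (b0 : 0 < b) (ba : b < a) (beta0 : 0 < beta).
Hypotheses (beta_a : beta != a) (beta_b : beta != b).
Hypothesis caustic : is_caustic beta T.

Let a0 : 0 < a. Proof. exact: lt_trans ba. Qed.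
Let a_neq0 : a != 0. Proof. exact: lt0r_neq0. Qed.
Let b_neq0 : b != 0. Proof. exact: lt0r_neq0. Qed.

Definition p1 k := pos T k 0 0.
Definition p2 k := pos T k 0 1.
Definition v1 k := vel T k 0 0.
Definition v2 k := vel T k 0 1.
Local Notation t := (flight T).
Let q1 k := p1 k + t k * v1 k.
Let q2 k := p2 k + t k * v2 k.

Lemma dotE (u v : 'rV[R]_2) : dot u v = u 0 0 * v 0 0 + u 0 1 * v 0 1.
Proof.
rewrite /dot mxE big_ord_recl big_ord1 !mxE.
by rewrite (_ : fintype.lift ord0 ord0 = 1 :> 'I_2) //; apply: val_inj.
Qed.

Lemma row2P (u v : 'rV[R]_2) : u 0 0 = v 0 0 -> u 0 1 = v 0 1 -> u = v.
Proof.
move=> E0 E1; apply/rowP => i.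
case: (unliftP 0 i) => [j ->|-> //]; rewrite ord1.
by rewrite (_ : fintype.lift 0 0 = 1 :> 'I_2) //; apply: val_inj.
Qed.

(** * Invariants of the motion: speed, caustic and Joachimsthal's integral *)

Let form1 (x y : R) := x ^+ 2 / a + y ^+ 2 / b.
Let form2 (x y u w : R) := x * u / a + y * w / b.
Let formE x y u w s :
  form1 (x + s * u) (y + s * w) = form1 x y + 2 * s * form2 x y u w + s ^+ 2 *
    form1 u w.
Proof. by rewrite /form1 /form2; field; rewrite ?a_neq0 ?b_neq0. Qed.

Let hitE k i : (pos T k + t k *: vel T k) 0 i = pos T k 0 i + t k * vel T k 0 i.
Proof. by rewrite !mxE. Qed.

Let on_hit k : form1 (q1 k) (q2 k) = 1.
Proof. by have := hit_boundary T k; rewrite /on_boundary !hitE. Qed.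

Let p1S k : p1 k.+1 = q1 k.
Proof. by rewrite /p1 pos_next mxE eqxx hitE. Qed.

Let p2S k : p2 k.+1 = - q2 k.
Proof. by rewrite /p2 pos_next mxE /= hitE. Qed.

Let m1 k := q1 k / a.
Let m2 k := q2 k / b.
Let vm k := v1 k * m1 k + v2 k * m2 k.
Let mm k := m1 k ^+ 2 + m2 k ^+ 2.
Definition bounce_coef k := vm k / mm k.
Local Notation mu := bounce_coef.

Let reflE k i : reflect_at a b (pos T k + t k *: vel T k) (vel T k) 0 i
  = vel T k 0 i - 2 * mu k * (if i == 0 then m1 k else m2 k).
Proof.
rewrite /reflect_at !mxE !dotE !mxE /= -/(p1 k) -/(p2 k) -/(v1 k) -/(v2 k).
rewrite -/(q1 k) -/(q2 k) -/(m1 k) -/(m2 k) /bounce_coef -/(vm k) -!expr2 -/(mm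
  k) mulrA.
by case: (i == 0).
Qed.

Let v1S k : v1 k.+1 = v1 k - 2 * mu k * m1 k.
Proof. by rewrite /v1 vel_next mxE /= reflE. Qed.

Let v2S k : v2 k.+1 = - (v2 k - 2 * mu k * m2 k).
Proof. by rewrite /v2 vel_next mxE /= reflE. Qed.

Let mm_gt0 k : 0 < mm k.
Proof.
rewrite lt_neqAle eq_sym addr_ge0 ?sqr_ge0 // andbT.
apply/eqP => /eqP; rewrite paddr_eq0 ?sqr_ge0 // !sqrf_eq0 !mulf_eq0 !invr_eq0.
rewrite (negPf a_neq0) (negPf b_neq0) !orbF => /andP[/eqP q10 /eqP q20].
by have := on_hit k; rewrite /form1 q10 q20 expr0n !mul0r addr0 => /eqP;
  rewrite eq_sym oner_eq0.
Qed.

Let mu_mm k : mu k * mm k = vm k.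
Proof. by rewrite /bounce_coef divfK // gt_eqF. Qed.

Let unit_v k : v1 k ^+ 2 + v2 k ^+ 2 = 1.
Proof.
elim: k => [|k IH]; first by have := unit_speed T; rewrite dotE -!expr2.
rewrite v1S v2S; transitivity (v1 k ^+ 2 + v2 k ^+ 2 + 4 * mu k * (mu k * mm k
  - vm k)).
  by rewrite /mm /vm; ring.
by rewrite IH mu_mm subrr mulr0 addr0.
Qed.

Let form1_v_gt0 k : 0 < form1 (v1 k) (v2 k).
Proof.
rewrite lt_neqAle eq_sym addr_ge0 ?divr_ge0 ?sqr_ge0 ?ltW // andbT.
apply/eqP => /eqP; rewrite paddr_eq0 ?divr_ge0 ?sqr_ge0 ?ltW //.
rewrite !mulf_eq0 !invr_eq0 (negPf a_neq0) (negPf b_neq0) !orbF !orbb.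
move=> /andP[/eqP v10 /eqP v20]; have := unit_v k.
by rewrite v10 v20 expr0n addr0 => /eqP; rewrite eq_sym oner_eq0.
Qed.

Let on_pos k : form1 (p1 k.+1) (p2 k.+1) = 1.
Proof. by rewrite p1S p2S /form1 sqrrN; apply: on_hit. Qed.

Let in_pos k : form1 (p1 k) (p2 k) <= 1.
Proof. by case: k => [|k]; [exact: pos0_in_table T | rewrite on_pos]. Qed.

Let vmE k : vm k = form2 (q1 k) (q2 k) (v1 k) (v2 k).
Proof. by rewrite /vm /m1 /m2 /form2; ring. Qed.

(** The particle reaches the boundary from a point of the table, so its velocity points outward at
    the impact: 2 vm is at least t times the positive value of [form1] at the velocity. *)
Let vm_gt0 k : 0 < vm k.
Proof.
have := in_pos k.
have -> : form1 (p1 k) (p2 k)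
    = 1 - 2 * t k * vm k + t k ^+ 2 * form1 (v1 k) (v2 k).
  have pq (x y : R) : x = x + t k * y + (- t k) * y by ring.
  rewrite {1}(pq (p1 k) (v1 k)) {1}(pq (p2 k) (v2 k)) formE -/(q1 k) -/(q2 k).
  by rewrite on_hit vmE; ring.
have f0 := form1_v_gt0 k; have t0 := flight_gt0 T k; move: f0 t0.
move: (form1 _ _) (t k) (vm k) => f s w f0 s0 H.
have : 0 < s * (2 * w).
  by apply: lt_le_trans (mulr_gt0 (exprn_gt0 2 s0) f0) _; move: H; lra.
by rewrite pmulr_rgt0 // pmulr_rgt0.
Qed.

(** Tangency in dual form: the line has a covector (u, w) with (a - beta) u^2 + (b - beta) w^2 =
    z0^2. Being orthogonal to the unit velocity, it is s (v2, - v1), and s is nonzero because (x0,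
    y0, z0) is. *)
Let betaE k :
  a * v2 k ^+ 2 + b * v1 k ^+ 2 - (p1 k * v2 k - p2 k * v1 k) ^+ 2 = beta.
Proof.
have [x0 [y0 [z0 [nz conic line]]]] := caustic k.
have ab0 : a - beta != 0 by rewrite subr_eq0 eq_sym.
have bb0 : b - beta != 0 by rewrite subr_eq0 eq_sym.
have P_t s i : (pos T k + s *: vel T k) 0 i = pos T k 0 i + s * vel T k 0 i.
  by rewrite !mxE.
have := line 0; have := line 1; rewrite !P_t -/(p1 k) -/(p2 k) -/(v1 k) -/(v2 k).
rewrite !mul0r !addr0 !mul1r => L1 L0.
pose u := x0 / (a - beta); pose w := y0 / (b - beta).
have x0E : x0 = (a - beta) * u by rewrite /u mulrC divfK.
have y0E : y0 = (b - beta) * w by rewrite /w mulrC divfK.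
have z0E : z0 = p1 k * u + p2 k * w by rewrite -L0 /u /w !mulrA.
have vuw : v1 k * u + v2 k * w = 0.
  apply: (addrI z0); rewrite addr0 -[RHS]L1 z0E /u /w; field; rewrite ?ab0 ?bb0 //.
pose s := u * v2 k - w * v1 k.
have uE : u = s * v2 k.
  transitivity (u * (v1 k ^+ 2 + v2 k ^+ 2)); first by rewrite unit_v mulr1.
  transitivity (s * v2 k + v1 k * (v1 k * u + v2 k * w)); first by rewrite /s; ring.
  by rewrite vuw mulr0 addr0.
have wE : w = - s * v1 k.
  transitivity (w * (v1 k ^+ 2 + v2 k ^+ 2)); first by rewrite unit_v mulr1.
  transitivity (- s * v1 k + v2 k * (v1 k * u + v2 k * w));
    first by rewrite /s; ring.
  by rewrite vuw mulr0 addr0.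
have s0 : s != 0.
  apply/eqP => s0; case: nz.
  by rewrite x0E y0E z0E uE wE s0 oppr0 !mul0r !mulr0 addr0.
clearbody s u w.
have conic' : (a - beta) * u ^+ 2 + (b - beta) * w ^+ 2 = z0 ^+ 2.
  by rewrite -conic x0E y0E; field; rewrite ?ab0 ?bb0.
apply: (mulfI (expf_neq0 2 s0)).
transitivity (((a - beta) * (s * v2 k) ^+ 2 + (b - beta) * (- s * v1 k) ^+ 2)
   - (p1 k * (s * v2 k) + p2 k * (- s * v1 k)) ^+ 2
   + s ^+ 2 * beta * (v1 k ^+ 2 + v2 k ^+ 2)); first by ring.
by rewrite -uE -wE conic' z0E subrr add0r unit_v mulr1.
Qed.

Let y0 := Num.sqrt (a * b * beta).
(** The constant value of Joachimsthal's integral, equal to the square root of beta / (a b). *)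
Let J := y0 / (a * b).

Let y0_gt0 : 0 < y0. Proof. by rewrite sqrtr_gt0 !mulr_gt0. Qed.
Let J_neq0 : J != 0.
Proof. by rewrite gt_eqF // divr_gt0 ?mulr_gt0. Qed.
Let abJ : a * b * J = y0.
Proof. by rewrite /J mulrC divfK // mulf_neq0. Qed.

(** An identity at the impact point gives (a b vm)^2 = a b beta, and vm > 0 selects the positive
    root, in accordance with the ordinate of Q_0. *)
Let vmJ k : vm k = J.
Proof.
have ab0 : 0 < a * b by rewrite mulr_gt0.
have H : (a * b * vm k) ^+ 2 = a * b * beta.
  have on : b * q1 k ^+ 2 + a * q2 k ^+ 2 = a * b.
    transitivity (a * b * form1 (q1 k) (q2 k)); last by rewrite on_hit mulr1.
    by rewrite /form1; field; rewrite ?a_neq0 ?b_neq0.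
  transitivity ((a * v2 k ^+ 2 + b * v1 k ^+ 2) * (b * q1 k ^+ 2 + a * q2 k ^+ 2)
     - a * b * (q1 k * v2 k - q2 k * v1 k) ^+ 2).
    by rewrite /vm /m1 /m2; field; rewrite ?a_neq0 ?b_neq0.
  rewrite on -[beta](betaE k) /q1 /q2; ring.
apply: (mulfI (lt0r_neq0 ab0)); rewrite abJ /y0 -H sqrtr_sqr gtr0_norm //.
by rewrite mulr_gt0.
Qed.

Lemma trajectory_orbit : billiard_orbit a b beta J p1 p2 v1 v2 t mu.
Proof.
split=> k.
- by have := on_hit k.
- by have := vmJ k.
- by rewrite -(vmJ k) -mu_mm.
- exact: unit_v.
- exact: betaE.
- exact: p1S.
- exact: p2S.
- exact: v1S.
exact: v2S.
Qed.

(** The bounds on the time follow: the line of motion after n hits is in the table exactly for times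
    from 0 to [flight T n], and the end of this flight cannot be an initial position with the same
    velocity. *)
Lemma n_periodicP n : (0 < n)%N -> n_periodic T n <->
  exists s, [/\ v1 n = v1 0, v2 n = v2 0, p1 n = p1 0 + s * v1 0
    & p2 n = p2 0 + s * v2 0].
Proof.
move=> n0; split=> [[s [_ pE vE]]|[s [E1 E2 E3 E4]]].
  exists (- s); split; rewrite ?/v1 ?/v2 ?/p1 ?/p2 ?vE //.
    by have := congr1 (fun u : 'rV_2 => u 0 0) pE; rewrite !mxE => ->; ring.
  by have := congr1 (fun u : 'rV_2 => u 0 1) pE; rewrite !mxE => ->; ring.
have vE : vel T 0 = vel T n by apply: row2P.
have pE : pos T 0 = pos T n - s *: vel T n.
  rewrite -vE; apply: row2P; rewrite !mxE.
    by apply/eqP; rewrite eq_sym subr_eq; apply/eqP.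
  by apply/eqP; rewrite eq_sym subr_eq; apply/eqP.
have on_n : form1 (p1 n) (p2 n) = 1 by rewrite -(prednK n0) on_pos.
have f0 := form1_v_gt0 n.
(* The line meets the boundary at the times 0 and [t n], the roots of this quadratic polynomial. *)
have along u : form1 (p1 n + u * v1 n) (p2 n + u * v2 n)
    = 1 + form1 (v1 n) (v2 n) * u * (u - t n).
  have := on_hit n; rewrite /q1 /q2 !formE on_n => H.
  have tn := lt0r_neq0 (flight_gt0 T n).
  have {}H : 2 * form2 (p1 n) (p2 n) (v1 n) (v2 n) = - t n * form1 (v1 n) (v2 n).
    apply: (mulfI tn); apply: (addrI 1);
      apply: (addIr (t n ^+ 2 * form1 (v1 n) (v2 n))).
    by rewrite mulrA [t n * 2]mulrC H; ring.
  rewrite -mulrA mulrCA H; ring.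
have p10 : p1 0 = p1 n + (- s) * v1 n by rewrite E3 E1; ring.
have p20 : p2 0 = p2 n + (- s) * v2 n by rewrite E4 E2; ring.
exists (- s); split; last by rewrite vE.
  have := in_pos 0; rewrite p10 p20 along gerDl -mulrA pmulr_rle0 //.
  have tn := flight_gt0 T n; move: (- s) p10 p20 => u p10 p20 H.
  have u0 : 0 <= u by rewrite leNgt; apply/negP => u0; move: H;
    rewrite leNgt nmulr_rgt0 // subr_lt0 (lt_trans u0).
  (* If u = [t n], the particle would start on the boundary and leave the table at once, yet its
     first hit comes at a positive time. *)
  rewrite u0 /= ltNge; apply/negP => ut.
  have {}ut : u = t n.
    apply/eqP; rewrite eq_le ut andbT leNgt; apply/negP => lt.
    by move: H; rewrite leNgt (pmulr_rgt0 _ (lt_trans tn lt)) subr_gt0 lt.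
  have := on_hit 0; have t0 := flight_gt0 T 0.
  rewrite /q1 /q2 p10 p20 -E1 -E2 -!addrA -!mulrDl along => /eqP.
  rewrite -subr_eq0 addrAC subrr add0r ut [t n + t 0]addrC addrK !mulf_eq0.
  by rewrite (gt_eqF f0) (gt_eqF (addr_gt0 t0 tn)) (gt_eqF t0).
by rewrite pE scaleNr.
Qed.

Lemma n_periodic_pell n : (0 < n)%N -> n_periodic T n ->
  exists A B, pell_solution a b beta y0 n A B.
Proof.
move=> n0 /(n_periodicP n0)[s [E1 E2 E3 E4]]; rewrite -abJ.
apply: (@pell_of_closed_orbit R a b beta J p1 p2 v1 v2 t mu a_neq0 b_neq0 J_neq0
  _ _ _ _ trajectory_orbit _ n (- s)) => //.
- by rewrite gt_eqF.
- by rewrite eq_sym.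
- by rewrite eq_sym.
- exact: lt0r_neq0.
- by move=> k; rewrite gt_eqF // flight_gt0.
- by rewrite E3 E1; ring.
by rewrite E4 E2; ring.
Qed.

Lemma pell_n_periodic n A B : (0 < n)%N ->
  pell_solution a%:C b%:C beta%:C y0%:C n A B -> n_periodic T n.
Proof.
move=> n0; have inj : injective (real_complex R) := fmorph_inj _.
have C_neq0 (u : R) : u != 0 -> u%:C != 0 by rewrite fmorph_eq0.
rewrite -abJ 2!rmorphM /= => AB.
have [tau [E1 E2 E3 E4]] := closed_orbit_of_pell (C_neq0 _ a_neq0)
  (C_neq0 _ b_neq0) (C_neq0 _ J_neq0) (orbit_map (real_complex R)
    trajectory_orbit) n0 AB.
(* [tau] is a priori complex; projecting the displacement on the unit velocity shows that it is
   real. *)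
apply/n_periodicP => //; pose s := (p1 n - p1 0) * v1 0 + (p2 n - p2 0) * v2 0.
have sE : s%:C = tau.
  have -> : tau = tau * (v1 0 ^+ 2 + v2 0 ^+ 2)%:C by rewrite unit_v mulr1.
  rewrite /s !(rmorphD, rmorphM, rmorphN, rmorphXn) /=.
  by move: E3 E4 => /= -> ->; ring.
exists s; split; apply: inj; [exact: E1 | exact: E2 | |].
  by rewrite rmorphD rmorphM /= sE.
by rewrite rmorphD rmorphM /= sE.
Qed.

End Trajectory.

Theorem theorem3p6 (R : realType) (a b beta : R) (T : trajectory a b) (n : nat)
    (hb : 0 < b) (hab : b < a)
    (hbeta : 0 < beta < b \/ b < beta < a)
    (hT : is_caustic beta T)
    (hn : (0 < n)%N) :
  n_periodic T n <->
    (~~ odd n /\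
       lin_equiv << n%:Z *g Q0 a b beta >> << n%:Z *g Qinf a b beta >>)
    \/ [/\ odd n, conic_hyperbola a b beta &
       lin_equiv << n%:Z *g Q0 a b beta >> << n%:Z *g Qb a b beta >>].
Proof.
have ha := lt_trans hb hab.
have ab : a != b by rewrite gt_eqF.
have [beta0 a_beta b_beta] : [/\ 0 < beta, a != beta & b != beta].
  case: hbeta => /andP[h1 h2]; split=> //.
  - by rewrite gt_eqF // (lt_trans h2).
  - by rewrite gt_eqF.
  - exact: lt_trans h1.
  - by rewrite gt_eqF.
  by rewrite lt_eqF.
have beta_a : beta != a by rewrite eq_sym.
have beta_b : beta != b by rewrite eq_sym.
split.
  move=> /(n_periodic_pell hb hab beta0 beta_a beta_b hT hn)[A [B AB]].
  have AB_C := pell_map (real_complex R) AB.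
  have [od|ev] := boolP (odd n); [right | left].
    split=> //; last exact: (lin_equiv_of_pell_odd ab a_beta b_beta ha hb beta0
      od AB_C).
    (* For odd n this gives b < beta, which leaves only the second case of [hbeta]. *)
    have := pell_odd_hyperbola hb hab od AB.
    case: hbeta => // /andP[_ beta_lt] /(lt_trans beta_lt).
    by rewrite ltxx.
  by split=> //; exact: (lin_equiv_of_pell_even ab a_beta b_beta ha hb beta0 hn
    ev AB_C).
case=> [[ev E]|[od _ E]].
  have [A [B AB]] := pell_of_lin_equiv_even ha hb beta0 hn ev E.
  exact: (pell_n_periodic hb hab beta0 beta_a beta_b hT hn AB).
have [A [B AB]] := pell_of_lin_equiv_odd ab b_beta ha hb beta0 od E.
exact: (pell_n_periodic hb hab beta0 beta_a beta_b hT hn AB).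
Qed.
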